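(* For any $v,w\in V$ and any integer $m\ge1$, $$\sum_{\substack{k+l=m\\ k,l\ge1}}\zeta\bigl(u\sigma(v)\circledast(\underbrace{1,\ldots,1}_{k})\bigr)\,\zeta\bigl(u\sigma(w)\circledast(\underbrace{1,\ldots,1}_{l})\bigr)=\zeta\bigl(u\sigma(v*w)\circledast(\underbrace{1,\ldots,1}_{m})\bigr).$$ (For $m=1$ the left-hand side is the empty sum $0$.)
   Context: A multi-index is a nonempty finite sequence $\mu=(\mu_1,\ldots,\mu_p)$ of positive integers, of length $l(\mu)=p$ and weight $|\mu|=\sum\mu_i$; $\phi$ denotes the empty multi-index. $V$ is the $\mathbb{Q}$-vector space with basis the set of all (nonempty) multi-indices. For multi-indices of the same weight write $\nu\ge\mu$ if $\nu$ is a refinement of $\mu$, i.e. $\{\mu_1+\cdots+\mu_k:1\le k<l(\mu)\}\subset\{\nu_1+\cdots+\nu_k:1\le k<l(\nu)\}$. Linear maps $\sigma,u\colon V\to V$ are given on multi-indices by $\sigma(\mu)=(-1)^{l(\mu)}\mu$ and $u(\mu)=\sum_{\nu\ge\mu}\nu$. Harmonic product: for multi-indices $\mu,\nu$, let $\mathcal{H}_{\mu,\nu}$ be the set of all $2\times l$ matrices $M=(m_{ij})$ ($l\ge1$ arbitrary) with non-negative integer entries such that deleting zeros from the first row gives $\mu$, deleting zeros from the second row gives $\nu$, and $m_{1j}+m_{2j}>0$ for all $j$. Put $\mu*\nu=\sum_{M\in\mathcal{H}_{\mu,\nu}}(m_{11}+m_{21},\ldots,m_{1l}+m_{2l})$,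 extended bilinearly, with $\phi*\mu=\mu*\phi=\mu$. For multi-indices $\mu=(\mu_1,\ldots,\mu_p)$, $\nu=(\nu_1,\ldots,\nu_q)$, put $$\mu\circledast\nu=\bigl((\mu_1,\ldots,\mu_{p-1})*(\nu_1,\ldots,\nu_{q-1})\bigr)\,\#\,(\mu_p+\nu_q),$$ where $\#$ is (bilinearly extended) concatenation and $(\mu_1,\ldots,\mu_{p-1})=\phi$ if $p=1$ (similarly for $\nu$); extend $\circledast$ bilinearly to $V\times V$. $V^+$ is the subspace of $V$ spanned by multi-indices whose last entry is $\ge2$, and $\zeta\colon V^+\to\mathbb{R}$ is the linear map with $\zeta(\mu_1,\ldots,\mu_p)=\sum_{0<n_1<\cdots<n_p}\frac{1}{n_1^{\mu_1}\cdots n_p^{\mu_p}}$. (Every $v\circledast w$ lies in $V^+$.) *)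

(* Defs.v *)
From HB Require Import structures.
From mathcomp Require Import all_boot all_order all_algebra.
From mathcomp Require Import all_classical all_reals all_analysis.
From mathcomp Require Import freeg.

Set Implicit Arguments.
Unset Strict Implicit.
Unset Printing Implicit Defensive.

Import Order.TTheory GRing.Theory Num.Theory.

Local Open Scope classical_set_scope.
Local Open Scope ring_scope.

(* Sequences of natural numbers, including the empty one [::] (written phi in
   the mathematics), serve as an ambient index set; the multi-indices are those
   that are nonempty and have only positive entries. *)
Definition multiindex (mu : seq nat) : bool :=
  (mu != [::]) && all (leq 1) mu.

Definition weight (mu : seq nat) : nat := sumn mu.

(* The ambient Q-vector space with basis all of [seq nat].  The maps below are
   defined on it by linear extension, but only their values on the subspace [V]
   (and, for the harmonic product, on the empty sequence) are of interest. *)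
Definition freeQ := {freeg (seq nat) / rat}.

Definition basis (mu : seq nat) : freeQ := << mu >>.

Definition spanned (P : pred (seq nat)) : {pred freeQ} :=
  [pred v : freeQ | all P (dom v)].

Definition V : {pred freeQ} := spanned multiindex.

Definition Vplus : {pred freeQ} :=
  spanned [pred mu | multiindex mu && (2 <= last 0 mu)%N].

Definition lift1 (f : seq nat -> freeQ) (v : freeQ) : freeQ := fglift f v.

Definition lift2 (f : seq nat -> seq nat -> freeQ) (v w : freeQ) : freeQ :=
  lift1 (fun mu => lift1 (f mu) w) v.

Definition partial_sums (mu : seq nat) : seq nat :=
  [seq sumn (take k mu) | k <- iota 1 (size mu).-1].

Definition refines (nu mu : seq nat) : Prop :=
  weight nu = weight mu /\ {subset partial_sums mu <= partial_sums nu}.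

Definition refinements (mu : seq nat) : set (seq nat) :=
  [set nu | multiindex nu /\ refines nu mu].

Definition sigma : freeQ -> freeQ :=
  lift1 (fun mu => (-1) ^+ size mu *: basis mu).

(* A [\sum_(_ \in _)] over a classical set is junk unless the set is finite;
   see [finite_refinements] and [finite_harmonic_matrices]. *)
Definition u : freeQ -> freeQ :=
  lift1 (fun mu => \sum_(nu \in refinements mu) basis nu).

(* A 2 x l matrix is the sequence of its l columns, so that [unzip1] and
   [unzip2] are its rows.  The constraint l >= 1 is automatic unless mu and nu
   are both empty; allowing l = 0 there gives phi * phi = phi. *)
Definition harmonic_matrices (mu nu : seq nat) : set (seq (nat * nat)) :=
  [set M | [/\ [seq x <- unzip1 M | x != 0%N] = mu,
               [seq x <- unzip2 M | x != 0%N] = nu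
             & forall c, c \in M -> (0 < c.1 + c.2)%N]].

Definition column_sums (M : seq (nat * nat)) : seq nat :=
  [seq (c.1 + c.2)%N | c <- M].

Definition harmonic_product : freeQ -> freeQ -> freeQ :=
  lift2 (fun mu nu => \sum_(M \in harmonic_matrices mu nu) basis (column_sums M)).

Definition concat : freeQ -> freeQ -> freeQ :=
  lift2 (fun mu nu => basis (mu ++ nu)).

Definition front (mu : seq nat) : seq nat := take (size mu).-1 mu.

Definition circ : freeQ -> freeQ -> freeQ :=
  lift2 (fun mu nu =>
    concat (harmonic_product (basis (front mu)) (basis (front nu)))
           (basis [:: (last 0 mu + last 0 nu)%N])).

Definition ones (k : nat) : freeQ := basis (nseq k 1%N).

(* The series has nonnegative terms, so its sum over all 0 < n_1 < ... < n_p is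
   an [esum]; it is finite when the last entry of mu is at least 2, and [fine]
   then reads it as a real number. *)
Definition multizeta (R : realType) (mu : seq nat) : R :=
  fine (\esum_(n in [set n : (size mu).-tuple nat | path ltn 0 n])
    (\prod_(i < size mu) (tnth n i)%:R ^- nth 0%N mu i)%:E).

(* Meaningful on [Vplus], which contains every [circ v w] by [circ_Vplus]. *)
Definition zeta (R : realType) (v : freeQ) : R :=
  \sum_(mu <- dom v) ratr (coeff mu v) * multizeta R mu.

Lemma finite_bounded_seq (T : choiceType) (t : seq T) (n : nat) :
  finite_set [set s : seq T | (size s <= n)%N /\ {subset s <= t}].
Proof.
apply: (@sub_finite_set _ _
  ((fun s : n.-bseq (seq_sub t) => map val s) @` setT)); last first.
  by apply: finite_image; exact: finite_finset.
move=> s [/= le_sn sub_st].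
have le_pn : (size (pmap (insub : T -> option (seq_sub t)) s) <= n)%N.
  by rewrite size_pmap (leq_trans (count_size _ _)).
exists (Bseq le_pn) => //=; rewrite pmap_filter; last exact: insubK.
apply/all_filterP/allP => x /sub_st x_t.
by rewrite /= insubT.
Qed.

Lemma finite_refinements (mu : seq nat) : finite_set (refinements mu).
Proof.
apply: (sub_finite_set _
  (finite_bounded_seq (iota 0 (weight mu).+1) (weight mu))).
move=> nu [/andP[_ nu_gt0] [<- _]]; split.
  elim: nu nu_gt0 => //= x s IHs /andP[x_gt0 /IHs le_s].
  by rewrite /weight /= -add1n leq_add.
move=> x x_nu; rewrite mem_iota add0n ltnS leq0n.
elim: nu x_nu {nu_gt0} => //= y s IHs; rewrite inE /weight /=.
by case/predU1P => [->|/IHs /leq_trans]; [exact: leq_addr|apply; exact: leq_addl].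
Qed.

Lemma finite_harmonic_matrices (mu nu : seq nat) :
  finite_set (harmonic_matrices mu nu).
Proof.
apply: (sub_finite_set _ (finite_bounded_seq
  [seq (x, y) | x <- 0%N :: mu, y <- 0%N :: nu] (size mu + size nu))).
move=> M [<- <- M_gt0]; split.
  elim: M M_gt0 => //= c M IHM M_gt0.
  have /IHM le_M : forall c, c \in M -> (0 < c.1 + c.2)%N.
    by move=> d dM; apply: M_gt0; rewrite inE dM orbT.
  have := M_gt0 c (mem_head _ _).
  case: (c.1) (c.2) => [|a] [|b] //= _; rewrite ?addSn ?addnS ltnS //.
  by rewrite ltnW ?ltnS.
move=> [x y] xyM; apply/allpairsP; exists (x, y); split => //=.
  rewrite inE mem_filter; case: eqP => //= _.
  by apply/mapP; exists (x, y).
rewrite inE mem_filter; case: eqP => //= _.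
by apply/mapP; exists (x, y).
Qed.

Lemma spanned_basis (P : pred (seq nat)) mu : P mu -> basis mu \in spanned P.
Proof. by move=> Pmu; rewrite inE /basis domU1 /= Pmu. Qed.

Lemma spanned_sum (P : pred (seq nat)) (I : eqType) (r : seq I) (F : I -> freeQ) :
  (forall i, i \in r -> F i \in spanned P) -> \sum_(i <- r) F i \in spanned P.
Proof.
move=> FP; rewrite big_seq; elim/big_ind: _ => [|v w vP wP|i /FP //].
  by rewrite inE dom0.
apply/allP => mu /domD_subset; rewrite mem_cat => /orP[].
  exact: (allP vP).
exact: (allP wP).
Qed.

Lemma lift1E (f : seq nat -> freeQ) v :
  lift1 f v = \sum_(mu <- dom v) coeff mu v *: f mu.
Proof.
by rewrite /lift1 -{1}[v]Freeg_dom fglift_Freeg /prelift big_map.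
Qed.

Lemma spanned_lift1 (P : pred (seq nat)) (f : seq nat -> freeQ) v :
  {in dom v, forall mu, f mu \in spanned P} -> lift1 f v \in spanned P.
Proof.
move=> fP; rewrite lift1E; apply: spanned_sum => mu /fP mu_P.
by apply/allP => nu /domZ_subset; exact: (allP mu_P).
Qed.

Lemma circ_Vplus v w : v \in V -> w \in V -> circ v w \in Vplus.
Proof.
have last_gt0 mu : multiindex mu -> (0 < last 0%N mu)%N.
  case: mu => // a mu /andP[_ /allP gt0]; apply: gt0; exact: mem_last.
move=> vV wV; apply: spanned_lift1 => mu /(allP vV) /last_gt0 mu_gt0.
apply: spanned_lift1 => nu /(allP wV) /last_gt0 nu_gt0.
set k := (_ + _)%N; have k_ge2 : (2 <= k)%N by rewrite /k -addn1 leq_add.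
apply: (@spanned_lift1 _ _ _) => s s_dom; apply: spanned_lift1 => t.
rewrite /basis domU1 inE => /eqP ->; apply: spanned_basis.
rewrite /= last_cat /= k_ge2 andbT /multiindex -size_eq0 size_cat addnS /=.
rewrite all_cat /= (ltnW k_ge2) !andbT.
suff : harmonic_product (basis (front mu)) (basis (front nu))
         \in spanned (all (leq 1)) by move/allP; exact.
apply: spanned_lift1 => a _; apply: spanned_lift1 => b _.
apply: spanned_sum => M; rewrite in_finite_support; last first.
  by apply: sub_finite_set (finite_harmonic_matrices a b) => N [].
rewrite inE => -[[_ _ M_gt0] _]; apply: spanned_basis.
by rewrite all_map; apply/allP => c /M_gt0.
Qed.

(* Main.v *)
(* For a multi-index mu let f_mu(N) be the sum of n_1^-mu_1 ... n_p^-mu_p over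
   0 < n_1 < ... < n_p <= N.  These truncated sums satisfy
   f_mu f_nu = f_(mu * nu), and their Newton series
   F_mu(z) = sum_k (Delta^k f_mu)(0) binom(z, k) interpolates them.  Since
   (Delta^k f_mu)(0) is, up to sign, the part of (u sigma mu) with largest
   summation index k, the m-th Taylor coefficient of F_mu(-X) at 0 is
   zeta(u sigma(mu) # (1, .., 1)) with # the circled product, and the theorem
   says that F_mu F_nu = F_(mu * nu) coefficientwise.  Truncating both series
   at K, the error in this identity is an explicit finite sum (Leibniz rule
   for differences and summation by parts); it is O((log K)^c / K) because
   |(Delta^(i+1) f_mu)(j)| is at most a power of log(i + j) times
   i! j! / (i + j + 1)!. *)

Require Import Defs.
From mathcomp Require Import all_boot all_order all_algebra.
From mathcomp Require Import all_classical all_reals all_analysis.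
From mathcomp Require Import freeg ring lra zify.

Set Implicit Arguments.
Unset Strict Implicit.
Unset Printing Implicit Defensive.

Import Order.TTheory GRing.Theory Num.Theory.
Import numFieldNormedType.Exports.

Local Open Scope classical_set_scope.
Local Open Scope ring_scope.

(** * Finite differences *)

Section FiniteDifferences.
Variable R : realFieldType.
Implicit Types (f g h : nat -> R) (i j k n : nat).

Definition nabla f : nat -> R := fun j => f j - f j.+1.

Fixpoint diff i f j : R :=
  if i is i'.+1 then diff i' f j - diff i' f j.+1 else f j.
Arguments diff : simpl never.

Lemma diffS i f j : diff i.+1 f j = diff i f j - diff i f j.+1.
Proof. by []. Qed.

Lemma diffSr i f j : diff i.+1 f j = diff i (nabla f) j.
Proof. by elim: i j => // i IH j; rewrite diffS !IH. Qed.

Lemma eq_diff i f g : f =1 g -> diff i f =1 diff i g.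
Proof. by move=> fg; elim: i => // i IH j; rewrite !diffS !IH. Qed.

Lemma diff_sum (I : Type) (r : seq I) (c : I -> R) (F : I -> nat -> R) i j :
  diff i (fun n => \sum_(x <- r) c x * F x n) j
  = \sum_(x <- r) c x * diff i (F x) j.
Proof.
elim: i j => // i IH j; rewrite diffS !IH -sumrB.
by apply: eq_bigr => x _; rewrite diffS mulrBr.
Qed.

Lemma diffN i f j : diff i (fun n => - f n) j = - diff i f j.
Proof. by elim: i j => // i IH j; rewrite !diffS !IH; ring. Qed.

Lemma diff1 i j : diff i (fun=> 1) j = (i == 0%N)%:R.
Proof. by elim: i j => // i IH j; rewrite diffS !IH subrr. Qed.

(** Leibniz rule with a linear factor, whose differences stop at order one. Read backwards, it
    recovers the differences of $f$ from those of $(n+1)f$, so division by $n+1$ can be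
    controlled. *)
Lemma diff_mul_succ f i j :
  diff i.+1 (fun n => n.+1%:R * f n) j
  = (i + j).+2%:R * diff i.+1 f j - i.+1%:R * diff i f j.
Proof.
elim: i j => [|i IH] j.
  by rewrite /diff /= /nabla -!natr1; ring.
by rewrite diffS !IH [diff i.+2 f j]diffS !(diffS i) !addSn addnS -!natr1; ring.
Qed.

(** This is $(i+j+1)!/(i!\,j!)$. Its reciprocal is $\int_0^1 x^j(1-x)^i\,dx$, the value of [diff i]
    at $j$ for the function $1/(n+1)$. *)
Definition kappa i j : R := (i + j).+1%:R * 'C(i + j, i)%:R.

Lemma kappa_gt0 i j : 0 < kappa i j.
Proof. by rewrite mulr_gt0 ?ltr0n ?bin_gt0 ?leq_addr. Qed.

Lemma kappa0 j : kappa 0 j = j.+1%:R.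
Proof. by rewrite /kappa bin0 mulr1. Qed.

Lemma kappai0 i : kappa i 0 = i.+1%:R.
Proof. by rewrite /kappa addn0 binn mulr1. Qed.

Lemma kappa_bin i j : kappa i j = i.+1%:R * 'C(i.+1 + j, i.+1)%:R.
Proof. by rewrite /kappa -!natrM addSn mul_bin_diag. Qed.

(* Summation by parts of the recursion [diff_mul_succ]. *)
Lemma kappa_diff f i j :
  kappa i j * diff i f j
  = \sum_(r < i.+1) 'C(r + j, r)%:R * diff r (fun n => n.+1%:R * f n) j.
Proof.
elim: i => [|i IH].
  by rewrite big_ord_recl big_ord0 kappa0 bin0 /diff /=; ring.
by rewrite big_ord_recr /= -IH diff_mul_succ (kappa_bin i) /kappa addSn; ring.
Qed.

Lemma sum_binS k (x : nat -> R) :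
  \sum_(i < k.+2) 'C(k.+1, i)%:R * x i
  = \sum_(i < k.+1) 'C(k, i)%:R * x i + \sum_(i < k.+1) 'C(k, i)%:R * x i.+1.
Proof.
have -> : \sum_(i < k.+1) 'C(k, i)%:R * x i = \sum_(i < k.+2) 'C(k, i)%:R * x i.
  by rewrite [RHS]big_ord_recr /= bin_small // mul0r addr0.
rewrite big_ord_recl [in RHS]big_ord_recl /= !bin0 -addrA -big_split /=.
by congr (_ + _); apply: eq_bigr => i _; rewrite /bump /= add1n binS natrD mulrDl.
Qed.

(** Leibniz rule, from $\nabla(fg)(n)=f(n+1)\nabla g(n)+\nabla f(n)g(n)$. Only $f$ is shifted, which
    is why its Newton series shows up at a moved base point in [newton_mul]. *)
Lemma diff_mul f g k j :
  diff k (fun n => f n * g n) j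
  = \sum_(i < k.+1) 'C(k, i)%:R * (diff i f (j + (k - i)) * diff (k - i) g j).
Proof.
elim: k f g j => [|k IH] f g j.
  by rewrite big_ord_recl big_ord0 /diff /= addn0 addr0 mul1r.
(* Phrased as a sum over a two-element list with coefficients 1, so that [diff_sum] applies. *)
have nablaM : nabla (fun n => f n * g n)
    =1 (fun n => \sum_(h <- [:: fun n => f n.+1 * nabla g n; fun n => nabla f n * g n]) 1 * h n).
  by move=> n; rewrite !big_cons big_nil /nabla; ring.
rewrite diffSr (eq_diff _ nablaM) diff_sum !big_cons big_nil !mul1r addr0 !IH.
rewrite (sum_binS _ (fun i => diff i f (j + (k.+1 - i)) * diff (k.+1 - i) g j)).
have diff_shift i n : diff i (fun n => f n.+1) n = diff i f n.+1.
  by elim: i n => // i IHi n; rewrite !diffS !IHi.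
congr (_ + _); apply: eq_bigr => i _; first by
  rewrite diff_shift -diffSr subSn ?addnS // -ltnS.
by rewrite -diffSr subSS.
Qed.

End FiniteDifferences.
Arguments diff : simpl never.

(** * Truncated Newton series *)

Section RisingFactorials.
Variable R : realFieldType.
Implicit Types (f g : nat -> R) (p q : {poly R}) (i j k l n I J K m : nat).

(** The binomial polynomial $\binom{X+j+i-1}{i}$. *)
Fixpoint rise j i : {poly R} :=
  if i is i'.+1 then i%:R^-1 *: (rise j i' * ('X + (j + i')%:R%:P)) else 1.

Arguments rise : simpl never.

Lemma riseS j i : rise j i.+1 = i.+1%:R^-1 *: (rise j i * ('X + (j + i)%:R%:P)).
Proof. by []. Qed.

Lemma riseSl j i : rise j i.+1 = i.+1%:R^-1 *: (('X + j%:R%:P) * rise j.+1 i).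
Proof.
elim: i => [|i IH]; first by rewrite riseS addn0 mulrC.
rewrite riseS IH [rise j.+1 i.+1]riseS addSnnS; congr (_ *: _).
by rewrite -scalerAl -scalerAr mulrA.
Qed.

(** Pascal's rule for these binomial polynomials. *)
Lemma rise_sub j i : rise j.+1 i.+1 - rise j.+1 i = rise j i.+1.
Proof.
have i1 : i.+1%:R != 0 :> R by rewrite pnatr_eq0.
rewrite (riseSl j) (riseS j.+1); apply: (scalerI i1).
rewrite scalerBr !scalerA divff // !scale1r -mul_polyC addSn -!natr1 !polyCD.
by rewrite !polyC1 natrD polyCD; ring.
Qed.

Lemma rise_mul a j i : rise a j * rise (a + j) i = 'C(i + j, i)%:R *: rise a (i + j).
Proof.
elim: i => [|i IH]; first by rewrite bin0 scale1r [rise _ 0]/rise mulr1.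
rewrite (riseS (a + j)) addSn (riseS a) -!scalerAr mulrA IH -scalerAl !scalerA.
rewrite -addnA (addnC j i); congr (_ *: _).
have i1 : i.+1%:R != 0 :> R by rewrite pnatr_eq0.
have ij1 : (i + j).+1%:R != 0 :> R by rewrite pnatr_eq0.
apply: (mulfI i1); rewrite mulrA divff // mul1r.
apply: (mulIf ij1); rewrite mulrA divfK // mulrC -!natrM.
by rewrite -mul_bin_diag mulnC.
Qed.

Lemma coef_rise_ge0 j i l : 0 <= (rise j i)`_l.
Proof.
elim: i l => [|i IH] l; first by rewrite [rise _ 0]/rise coef1 ler0n.
rewrite riseS coefZ mulr_ge0 // ?invr_ge0 ?ler0n //.
rewrite mulrDr coefD coefMX coefMC addr_ge0 ?mulr_ge0 ?ler0n //.
by case: ifP.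
Qed.

(* [diff k] is (-1)^k times the forward difference and [rise 0 k] is (-1)^k
   binom(-'X, k), so this is the truncated Newton series of [f] at -'X. *)
Definition newton K f : {poly R} := \sum_(k < K.+1) diff k f 0 *: rise 0 k.

(** The truncated Newton series at [-'X] built on the nodes $j,j+1,\ldots$ instead of $0,1,\ldots$;
    changing $j$ costs only boundary terms. *)
Definition shifted_newton I j f : {poly R} := \sum_(i < I.+1) diff i f j *: rise j i.

(* Summation by parts, using [diff i f j.+1 = diff i f j - diff i.+1 f j]. *)
Lemma shifted_newtonS I j f :
  shifted_newton I j.+1 f = shifted_newton I j f - diff I.+1 f j *: rise j.+1 I.
Proof.
elim: I => [|I IH].
  rewrite /shifted_newton !big_ord_recl !big_ord0 /=.
  by rewrite !addr0 -scalerBl [diff 1 _ _]diffS opprB addrC subrK.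
rewrite /shifted_newton big_ord_recr [in RHS]big_ord_recr /= -!/(shifted_newton _ _ _) IH.
by rewrite -(rise_sub j I) (diffS I.+1) -!mul_polyC (polyCB (diff I.+1 f j)); ring.
Qed.

Lemma shifted_newtonE I j f :
  shifted_newton I j f = shifted_newton I 0 f - \sum_(r < j) diff I.+1 f r *: rise r.+1 I.
Proof.
elim: j => [|j IH]; first by rewrite big_ord0 subr0.
by rewrite shifted_newtonS IH big_ord_recr /= opprD addrA.
Qed.

Lemma sum_triangle (M : nmodType) (F : nat -> nat -> M) K :
  \sum_(k < K.+1) \sum_(i < k.+1) F i (k - i)%N
  = \sum_(j < K.+1) \sum_(i < (K - j).+1) F i j.
Proof.
elim: K => [|K IH]; first by rewrite !big_ord_recl !big_ord0.
rewrite big_ord_recr /= IH.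
have -> : \sum_(i < K.+2) F i (K.+1 - i)%N = \sum_(j < K.+1) F (K.+1 - j)%N j + F 0%N K.+1.
  rewrite (reindex_inj rev_ord_inj) big_ord_recr /= subnn subn0; congr (_ + _).
  by apply: eq_bigr => j _; rewrite subSS subKn // ltnW // ltnW.
rewrite [in RHS]big_ord_recr /= subnn big_ord1 addrA.
rewrite -big_split /=; congr (_ + _); apply: eq_bigr => j _.
have jK : (j <= K)%N by rewrite -ltnS.
by rewrite subSn // [RHS]big_ord_recr.
Qed.

(** The Leibniz binomial is the one of [rise_mul], so every term factors. Collecting by the order
    $j$ of the difference of $g$ leaves a Newton series of $f$ based at $j$. *)
Lemma newton_mul K f g :
  newton K (fun n => f n * g n)
  = \sum_(j < K.+1) diff j g 0 *: (rise 0 j * shifted_newton (K - j) j f).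
Proof.
rewrite /newton.
under eq_bigr => k _ do rewrite diff_mul scaler_suml.
pose F i j := diff j g 0 *: (rise 0 j * (diff i f j *: rise j i)).
rewrite (eq_bigr (fun k : 'I_K.+1 => \sum_(i < k.+1) F i (k - i)%N)) => [|k _].
  rewrite sum_triangle; apply: eq_bigr => j _.
  by rewrite /F -scaler_sumr -mulr_sumr.
apply: eq_bigr => i _; rewrite /F add0n -(scalerAr _ (rise 0 _)).
have := rise_mul 0 (k - i) i; rewrite add0n => ->.
rewrite subnKC; last by rewrite -ltnS.
by rewrite !scalerA; congr (_ *: _); ring.
Qed.

(** The first inner sum is the cost of moving the base point of the series of $f$ from $j$ to 0. The
    second is the part of [newton K f] of order above $K-j$, which truncating the product at $K$
    omits. *)
Lemma newton_mul_sub K f g :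
  newton K g * newton K f - newton K (fun n => f n * g n)
  = \sum_(j < K.+1) diff j g 0 *:
      (\sum_(r < j) diff (K - j).+1 f r *: (rise 0 j * rise r.+1 (K - j))
       + \sum_((K - j).+1 <= i < K.+1) diff i f 0 *: (rise 0 j * rise 0 i)).
Proof.
rewrite newton_mul {1}/newton mulr_suml -sumrB; apply: eq_bigr => j _.
rewrite -scalerAl -scalerBr -mulrBr shifted_newtonE opprB addrCA; congr (_ *: _).
rewrite mulrDr mulr_sumr; congr (_ + _).
  by apply: eq_bigr => r _; rewrite scalerAr.
rewrite /newton /shifted_newton -!(big_mkord xpredT (fun i => diff i f 0 *: rise 0 i)).
rewrite (@big_cat_nat _ _ _ (K - j).+1 0 K.+1) ?ltnS ?leq_subr //= addrC addKr.
by rewrite mulr_sumr; apply: eq_bigr => r _; rewrite scalerAr.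
Qed.

End RisingFactorials.
Arguments rise : simpl never.

(** * The truncation error *)

Section LogarithmicGrowth.
Variable R : realFieldType.
Implicit Types (f g : nat -> R) (p q : {poly R}) (i j k l n I J K m c d x : nat).

(** A harmonic number plays the role of the logarithm; the extra 1 makes powers increase with the
    exponent. *)
Definition ell n : R := 1 + \sum_(r < n) r.+1%:R^-1.

Lemma ellS n : ell n.+1 = ell n + n.+1%:R^-1.
Proof. by rewrite /ell big_ord_recr addrA. Qed.

Lemma ell_ge1 n : 1 <= ell n.
Proof. by rewrite lerDl sumr_ge0 // => r _; rewrite invr_ge0. Qed.

Lemma ell_ge0 n : 0 <= ell n.
Proof. exact: le_trans ler01 (ell_ge1 n). Qed.

Hint Resolve ell_ge0 ell_ge1 : core.

Lemma ell_le n m : (n <= m)%N -> ell n <= ell m.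
Proof.
elim: m => [|m IH]; first by rewrite leqn0 => /eqP->.
rewrite leq_eqVlt => /predU1P[->//|/IH /le_trans]; apply.
by rewrite ellS lerDl invr_ge0.
Qed.

Lemma ellX_le n m c d : (n <= m)%N -> (c <= d)%N -> ell n ^+ c <= ell m ^+ d.
Proof.
move=> nm cd; apply: le_trans (ler_weXn2l (ell_ge1 m) cd).
by rewrite lerXn2r ?nnegrE // ell_le.
Qed.

(** Order $i+1$ is weighed by [kappa i j] because one difference turns a sum over $n<N$ into its
    summand, whose factor $1/(n+1)$ has $i$-th differences of size [1 / kappa i j]. *)
Definition logbd c f :=
  (forall j, `|f j| <= ell j ^+ c) /\
  (forall i j, kappa R i j * `|diff i.+1 f j| <= ell (i + j).+1 ^+ c).

Lemma logbd1 : logbd 0 (fun=> 1).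
Proof.
split=> [j|i j]; first by rewrite normr1.
by rewrite diff1 normr0 mulr0.
Qed.

Lemma kappa_diff_le f i j (b : nat -> R) :
  (forall r, (r <= i)%N ->
     'C(r + j, r)%:R * `|diff r (fun n => n.+1%:R * f n) j| <= b r) ->
  kappa R i j * `|diff i f j| <= \sum_(r < i.+1) b r.
Proof.
move=> fb; rewrite -(ger0_norm (ltW (kappa_gt0 R i j))) -normrM kappa_diff.
apply: le_trans (ler_norm_sum _ _ _) _; apply: ler_sum => r _.
by rewrite normrM normr_nat fb // -ltnS.
Qed.

(** Each division by $n+1$ goes through [kappa_diff] and costs one harmonic sum, hence one more
    factor [ell]. *)
Lemma logbd_div c f x i j : logbd c f ->
  kappa R i j * `|diff i (fun n => n.+1%:R ^- x.+1 * f n) j| <= ell (i + j).+1 ^+ (c + x.+1).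
Proof.
move=> [f_bd df_bd]; elim: x i j => [|x IH] i j.
  (* The term $r=0$ uses the bound on values. For $r>0$, [kappa_bin] turns the binomial into [kappa]
     of order $r-1$ divided by $r$; the weights $1,1/1,\ldots,1/i$ add up to [ell i]. *)
  pose b r : R := (if r is r'.+1 then r%:R^-1 else 1) * ell (i + j).+1 ^+ c.
  apply: le_trans (@kappa_diff_le _ _ _ b _) _ => [r ri|].
    rewrite (@eq_diff _ r _ f) => [|n]; last by rewrite expr1 mulVKf ?pnatr_eq0.
    rewrite /b; case: r ri => [|r] ri.
      rewrite bin0 !mul1r; apply: le_trans (f_bd j) _.
      by rewrite ellX_le // leqW // leq_addl.
    rewrite -(ler_pM2l (ltr0Sn R r)) !mulrA -kappa_bin divff ?pnatr_eq0 // mul1r.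
    by apply: le_trans (df_bd r j) _; rewrite ellX_le // ltnS leq_add2r ltnW.
  rewrite -mulr_suml addn1 exprS ler_wpM2r ?exprn_ge0 //.
  rewrite big_ord_recl /= -/(ell i) ell_le //.
  by rewrite leqW // leq_addr.
(* Here the binomial is [kappa r j] divided by $r+j+1\ge r+1$. *)
pose b r : R := r.+1%:R^-1 * ell (i + j).+1 ^+ (c + x.+1).
apply: le_trans (@kappa_diff_le _ _ _ b _) _ => [r ri|].
  rewrite (@eq_diff _ r _ (fun n => n.+1%:R ^- x.+1 * f n)) => [|n]; last first.
    by rewrite [in LHS]exprS invfM !mulrA divff ?pnatr_eq0 // mul1r.
  have rj0 : 0 < (r + j).+1%:R :> R by rewrite ltr0n.
  rewrite /b -(ler_pM2l rj0) !mulrA -/(kappa R r j).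
  apply: le_trans (IH r j) _.
  apply: (@le_trans _ _ (1 * ell (i + j).+1 ^+ (c + x.+1))).
    by rewrite mul1r ellX_le // ltnS leq_add2r.
  rewrite ler_wpM2r ?exprn_ge0 // ler_pdivlMr ?ltr0n // mul1r ler_nat.
  by rewrite ltnS leq_addr.
rewrite -mulr_suml (addnS c x.+1) exprS ler_wpM2r ?exprn_ge0 //.
apply: (@le_trans _ _ (ell i.+1)); first by rewrite /ell lerDr.
by rewrite ell_le // ltnS leq_addr.
Qed.

Lemma nabla_sum f j : nabla (fun N => \sum_(n < N) f n) j = - f j.
Proof. by rewrite /nabla big_ord_recr opprD addNKr. Qed.

Lemma diffS_sum f i j : diff i.+1 (fun N => \sum_(n < N) f n) j = - diff i f j.
Proof. by rewrite diffSr (eq_diff _ (nabla_sum f)) diffN. Qed.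

Lemma logbd_sum c f x : logbd c f ->
  logbd (c + x.+1) (fun N => \sum_(n < N) n.+1%:R ^- x.+1 * f n).
Proof.
move=> fb; split=> [j|i j]; last first.
  by rewrite (diffS_sum (fun n => n.+1%:R ^- x.+1 * f n)) normrN logbd_div.
case: (fb) => f_bd _.
apply: (@le_trans _ _ (\sum_(n < j) n.+1%:R^-1 * ell j ^+ c)).
  apply: le_trans (ler_norm_sum _ _ _) _; apply: ler_sum => n _.
  rewrite normrM ler_pM // ?normr_ge0 //; last first.
    by apply: le_trans (f_bd n) _; rewrite ellX_le // ltnW.
  rewrite ger0_norm ?invr_ge0 ?exprn_ge0 // lef_pV2 ?posrE ?exprn_gt0 ?ltr0n //.
  by rewrite exprS ler_peMr // exprn_ege1 // ler1n.
rewrite -mulr_suml addnC exprD ler_wpM2r ?exprn_ge0 //.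
apply: (@le_trans _ _ (ell j)); first by rewrite /ell lerDr.
by rewrite exprS ler_peMr // exprn_ege1.
Qed.

Definition polybd (e a : R) p := forall l, 0 <= p`_l <= a * e ^+ l.

Lemma polybdM e a b p q : 0 <= e ->
  polybd e a p -> polybd e b q -> forall m, `|(p * q)`_m| <= m.+1%:R * (a * b) * e ^+ m.
Proof.
move=> e0 pb qb m; rewrite coefM ger0_norm; last first.
  by rewrite sumr_ge0 // => i _; rewrite mulr_ge0 //;
     [case/andP: (pb i)|case/andP: (qb (m - i)%N)].
apply: (@le_trans _ _ (\sum_(i < m.+1) a * b * e ^+ m)); last first.
  by rewrite sumr_const card_ord -[leLHS]mulr_natl mulrA.
apply: ler_sum => i _.
have /andP[p0 pa] := pb i; have /andP[q0 qa] := qb (m - i)%N.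
apply: le_trans (ler_pM p0 q0 pa qa) _.
by rewrite mulrACA -exprD subnKC // -ltnS.
Qed.

(** [rise R 1 n] is $\prod_{r=1}^n(1+X/r)$; its $l$-th coefficient is an elementary symmetric
    function of $1,\ldots,1/n$, so at most the $l$-th power of their sum. *)
Lemma rise1_bd n K : (n <= K)%N -> polybd (ell K) 1 (rise R 1 n).
Proof.
move=> nK l; rewrite coef_rise_ge0 mul1r /=.
apply: (@le_trans _ _ (ell n ^+ l)); last by rewrite ellX_le.
elim: n l {nK} => [|n IH] l.
  by rewrite [rise _ _ _]/rise coef1 /ell big_ord0 addr0 expr1n; case: eqP.
rewrite riseS add1n coefZ mulrDr coefD coefMX coefMC.
case: l => [|l] /=.
  by rewrite add0r mulrCA mulVf ?pnatr_eq0 // mulr1 (le_trans (IH 0%N)).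
rewrite mulrDr [_^-1 * (_ * _)]mulrCA mulVf ?pnatr_eq0 // mulr1.
rewrite exprS ellS mulrDl addrC lerD //.
  apply: le_trans (IH _) _; rewrite exprS ler_wpM2l //.
  by rewrite -ellS ellX_le.
by rewrite ler_wpM2l ?invr_ge0 //; apply: le_trans (IH _) _; rewrite -ellS ellX_le.
Qed.

Lemma rise0_bd n K : (n.+1 <= K)%N -> polybd (ell K) n.+1%:R^-1 (rise R 0 n.+1).
Proof.
move=> nK l; rewrite coef_rise_ge0 /= riseSl addr0 coefZ ler_wpM2l ?invr_ge0 //.
rewrite mulrC coefMX; case: l => [|l] /=; first by [].
have /andP[_] := rise1_bd (ltnW nK) l; rewrite mul1r => /le_trans; apply.
exact: ellX_le.
Qed.

Lemma coef0_rise1 n : (rise R 1 n)`_0 = 1.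
Proof.
elim: n => [|n IH]; first by rewrite [rise _ _ _]/rise coef1.
by rewrite riseS add1n coefZ mulrDr coefD coefMX coefMC IH add0r mul1r mulVf ?pnatr_eq0.
Qed.

(** Multiplying by [rise R 1 r], which has constant term 1 and nonnegative coefficients, can only
    increase coefficients, and by [rise_mul] the product is a multiple of [rise R 1 (I + r)]. *)
Lemma rise_bd r I K : (I + r <= K)%N ->
  polybd (ell K) 'C(I + r, I)%:R (rise R r.+1 I).
Proof.
move=> rI l; rewrite coef_rise_ge0 /=.
have /andP[_] := rise1_bd rI l; rewrite mul1r => bd.
apply: (@le_trans _ _ ('C(I + r, I)%:R * (rise R 1 (I + r))`_l)); last first.
  by rewrite ler_wpM2l.
rewrite -coefZ -(rise_mul R 1 r I) coefM big_ord_recl /= subn0 coef0_rise1 mul1r.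
by rewrite lerDl sumr_ge0 // => i _; rewrite mulr_ge0 ?coef_rise_ge0.
Qed.

(** Partial fractions: $(K+1)/((j+1)(K-j))=1/(j+1)+1/(K-j)$, and both halves sum to the same
    harmonic number. *)
Lemma sum_inv_mul_rev K :
  \sum_(j < K) (j.+1%:R * (K - j)%:R)^-1 <= 2 * ell K / K.+1%:R :> R.
Proof.
rewrite ler_pdivlMr ?ltr0n // mulr_suml.
have -> : \sum_(j < K) (j.+1%:R * (K - j)%:R)^-1 * K.+1%:R
  = \sum_(j < K) j.+1%:R^-1 + \sum_(j < K) j.+1%:R^-1 :> R.
  rewrite [X in _ = _ + X](reindex_inj rev_ord_inj) -big_split /=.
  apply: eq_bigr => j _; have jK := ltn_ord j.
  rewrite -subSn // subSS invfM.
  have -> : K.+1%:R = j.+1%:R + (K - j)%:R :> R by rewrite -natrD addSn subnKC // ltnW.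
  rewrite mulrDr; have h1 : j.+1%:R != 0 :> R by rewrite pnatr_eq0.
  have h2 : (K - j)%:R != 0 :> R by rewrite pnatr_eq0 subn_eq0 -ltnNge.
  by field; rewrite h2 addrC natr1.
have : \sum_(j < K) j.+1%:R^-1 <= ell K by rewrite /ell lerDr.
lra.
Qed.

Lemma diff0_le c f i K : logbd c f -> (i.+1 <= K)%N ->
  `|diff i.+1 f 0| <= ell K ^+ c / i.+1%:R.
Proof.
move=> [_ fb] iK; rewrite ler_pdivlMr ?ltr0n // mulrC -kappai0.
by apply: le_trans (fb i 0%N) _; rewrite ellX_le // addn0.
Qed.

(** At order $j$ of $g$ each boundary sum is $O(1/(K-j+1))$ up to powers of [ell], and the
    difference of $g$ contributes $1/j$. Summing the products with [sum_inv_mul_rev] gains $1/(K+1)$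
    for one more [ell]. *)
Lemma newton_mul_le c d f g K m : logbd c f -> logbd d g ->
  `|(newton K g * newton K f - newton K (fun n => f n * g n))`_m|
  <= 4 * m.+1%:R * ell K ^+ (c + d + m).+1 / K.+1%:R.
Proof.
move=> fb gb; rewrite newton_mul_sub coef_sum.
set E := ell K; have E0 : 0 <= E by exact: ell_ge0.
(* The term $j=0$ vanishes: no base point moves and no order exceeds $K$. From here on the order is
   [j.+1]. *)
rewrite big_ord_recl /= big_ord0 big_geq ?subn0 // addr0 scaler0 coef0 add0r.
apply: (@le_trans _ _ (2 * m.+1%:R * E ^+ (c + d + m)
                       * \sum_(j < K) (j.+1%:R * (K - j)%:R)^-1)); last first.
  have -> : 4 * m.+1%:R * E ^+ (c + d + m).+1 / K.+1%:R
    = 2 * m.+1%:R * E ^+ (c + d + m) * (2 * E / K.+1%:R) by rewrite exprSr; ring.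
  by rewrite ler_wpM2l ?mulr_ge0 ?exprn_ge0 ?sum_inv_mul_rev.
apply: le_trans (ler_norm_sum _ _ _) _; rewrite mulr_sumr; apply: ler_sum => j _.
rewrite coefZ normrM /bump /= add1n; set I := (K - j.+1)%N.
have jK := ltn_ord j.
have KjE : (K - j)%N = I.+1 by rewrite /I subnSK.
rewrite KjE.
set B := m.+1%:R * E ^+ (c + m) / I.+1%:R.
suff : `|(\sum_(r < j.+1) diff I.+1 f r *: (rise R 0 j.+1 * rise R r.+1 I)
   + \sum_(I.+1 <= i < K.+1) diff i f 0 *: (rise R 0 j.+1 * rise R 0 i))`_m| <= B + B.
  move=> /(ler_pM (normr_ge0 _) (normr_ge0 _) (diff0_le gb jK)) /le_trans; apply.
  rewrite le_eqVlt; apply/orP; left; apply/eqP; rewrite /B -/E !exprD invfM; ring.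
rewrite coefD; apply: le_trans (ler_normD _ _) _; apply: lerD.
  rewrite coef_sum; apply: le_trans (ler_norm_sum _ _ _) _.
  (* Both inner sums have [j.+1] terms, each at most [B / j.+1%:R]. *)
  apply: (@le_trans _ _ (\sum_(r < j.+1) B / j.+1%:R)); last first.
    by rewrite sumr_const card_ord -[leLHS]mulr_natl mulrC divfK ?pnatr_eq0.
  apply: ler_sum => r _; rewrite coefZ normrM.
  have IrK : (I + r < K)%N.
    by apply: (@leq_trans (I + j.+1)); rewrite ?ltn_add2l ?subnK.
  have := polybdM E0 (rise0_bd jK) (rise_bd (ltnW IrK)) m.
  have h : `|diff I.+1 f r| <= E ^+ c / kappa R I r.
    rewrite ler_pdivlMr ?kappa_gt0 // mulrC; case: fb => _ fb.
    by apply: le_trans (fb I r) _; rewrite ellX_le.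
  move=> /(ler_pM (normr_ge0 _) (normr_ge0 _) h) /le_trans; apply.
  have C0 : 'C(I + r, I)%:R != 0 :> R by rewrite pnatr_eq0 -lt0n bin_gt0 leq_addr.
  (* The binomial inside [kappa] cancels the one from [rise_bd], leaving $1/(I+r+1)\le 1/(I+1)$. *)
  have -> : E ^+ c / kappa R I r * (m.+1%:R * (j.+1%:R^-1 * 'C(I + r, I)%:R) * E ^+ m)
     = (m.+1%:R * E ^+ (c + m)) * (I + r).+1%:R^-1 * j.+1%:R^-1.
    have regroup (a b x y z t : R) : b != 0 ->
        x / (a * b) * (y * (z * b) * t) = y * (x * t) * a^-1 * z.
      by move=> b0; rewrite invfM -[RHS]mul1r -(divff b0); ring.
    by rewrite /kappa regroup // exprD.
  rewrite ler_wpM2r ?invr_ge0 // ler_wpM2l ?mulr_ge0 ?exprn_ge0 //.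
  by rewrite lef_pV2 ?posrE ?ltr0n // ler_nat ltnS leq_addr.
rewrite coef_sum; apply: le_trans (ler_norm_sum _ _ _) _.
apply: (@le_trans _ _ (\sum_(I.+1 <= i < K.+1) B / j.+1%:R)); last first.
  rewrite sumr_const_nat -[leLHS]mulr_natl subSS subKn //.
  by rewrite mulrC divfK ?pnatr_eq0.
rewrite !big_nat; apply: ler_sum => -[//|i] /andP[Ii]; rewrite ltnS => iK.
rewrite coefZ normrM.
have := polybdM E0 (rise0_bd jK) (rise0_bd iK) m.
move=> /(ler_pM (normr_ge0 _) (normr_ge0 _) (diff0_le fb iK)) /le_trans; apply.
have -> : ell K ^+ c / i.+1%:R * (m.+1%:R * (j.+1%:R^-1 * i.+1%:R^-1) * E ^+ m)
   = (m.+1%:R * E ^+ (c + m)) * (i.+1%:R * i.+1%:R)^-1 * j.+1%:R^-1.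
  by rewrite exprD -/E invfM; ring.
rewrite ler_wpM2r ?invr_ge0 // ler_wpM2l ?mulr_ge0 ?exprn_ge0 //.
rewrite lef_pV2 ?posrE ?mulr_gt0 ?ltr0n // -natrM ler_nat.
by rewrite (leq_trans Ii) // leq_pmulr.
Qed.

End LogarithmicGrowth.

(** * Convergence of series with logarithmic numerators *)

Section LogarithmicSeries.
Variable R : realFieldType.
Implicit Types (c k n N : nat).

Lemma subrX_le (a b : R) c : 0 <= a <= b ->
  b ^+ c.+1 - a ^+ c.+1 <= c.+1%:R * b ^+ c * (b - a).
Proof.
move=> /andP[a0 ab]; have b0 := le_trans a0 ab.
elim: c => [|c IH]; first by rewrite !expr1 expr0 !mul1r.
have -> : b ^+ c.+2 - a ^+ c.+2 = b * (b ^+ c.+1 - a ^+ c.+1) + a ^+ c.+1 * (b - a).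
  by rewrite !(exprS _ c.+1); ring.
have -> : c.+2%:R * b ^+ c.+1 * (b - a)
    = b * (c.+1%:R * b ^+ c * (b - a)) + b ^+ c.+1 * (b - a).
  by rewrite -[c.+2%:R]natr1 exprS; ring.
by rewrite lerD ?ler_wpM2l // ler_wpM2r ?subr_ge0 // lerXn2r.
Qed.

Lemma inv_sqr_le n : n.+1%:R ^- 2 <= 2 / (n.+1%:R * n.+2%:R) :> R.
Proof.
rewrite ler_pdivlMr ?mulr_gt0 ?ltr0n // expr2 invfM mulrACA mulVf ?pnatr_eq0 // mul1r.
by rewrite mulrC ler_pdivrMr ?ltr0n // -natrM ler_nat mul2n -addnn addSn addnS !ltnS leq_addl.
Qed.

(** Abel summation with $1/((k+1)(k+2))=1/(k+1)-1/(k+2)$. Thanks to the boundary term, the left side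
    grows only through differences of powers of [ell], which lower the exponent by one; hence an
    induction on [c]. *)
Lemma ell_telescope c : exists M : R, forall N,
  \sum_(k < N) ell R k.+1 ^+ c / (k.+1%:R * k.+2%:R) + ell R N.+1 ^+ c / N.+1%:R <= M.
Proof.
pose F c k : R := ell R k.+1 ^+ c / (k.+1%:R * k.+2%:R).
pose S c N : R := \sum_(k < N) F c k + ell R N.+1 ^+ c / N.+1%:R.
have F0 d k : 0 <= F d k.
  by rewrite /F divr_ge0 ?mulr_ge0 ?exprn_ge0 ?ell_ge0.
have SS d N : S d N.+1 = S d N + (ell R N.+2 ^+ d - ell R N.+1 ^+ d) / N.+2%:R.
  rewrite /S big_ord_recr /= /F invfM.
  have h1 : N.+1%:R != 0 :> R by rewrite pnatr_eq0.
  have h2 : N.+2%:R != 0 :> R by rewrite pnatr_eq0.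
  have -> : N.+1%:R^-1 / N.+2%:R = N.+1%:R^-1 - N.+2%:R^-1 :> R.
    by rewrite -[N.+2%:R]natr1 in h2 *; field; rewrite -!natr1 in h1 h2 *; apply/andP.
  ring.
suff [M SM] : exists M, forall N, S c N <= M by exists M.
elim: c => [|c [M SM]].
  exists (S 0%N 0%N); elim=> // N; rewrite SS !expr0 subrr mul0r addr0 //.
exists (S c.+1 0%N + 2 * c.+1%:R * M) => N.
have SN : S c.+1 N <= S c.+1 0%N + 2 * c.+1%:R * \sum_(k < N) F c k.+1.
  elim: N => [|N IH]; first by rewrite big_ord0 mulr0 addr0.
  rewrite SS big_ord_recr /= mulrDr addrA lerD //.
  apply: (@le_trans _ _ (c.+1%:R * ell R N.+2 ^+ c * (N.+2%:R ^- 2))).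
    rewrite -exprVn expr2 mulrA ler_wpM2r ?invr_ge0 //.
    apply: le_trans (subrX_le _ _) _; first by rewrite ell_ge0 ell_le.
    by rewrite [ell R N.+2]ellS [_ + _ - _]addrC addKr.
  rewrite /F; apply: le_trans (ler_wpM2l _ (inv_sqr_le N.+1)) _.
    by rewrite mulr_ge0 ?exprn_ge0 ?ell_ge0.
  by rewrite le_eqVlt; apply/orP; left; apply/eqP; ring.
apply: le_trans SN _; rewrite lerD2l ler_wpM2l ?mulr_ge0 //.
apply: le_trans (SM N.+1); rewrite /S big_ord_recl /=.
rewrite -addrA [leRHS]addrCA lerDl addr_ge0 //.
by rewrite divr_ge0 ?exprn_ge0 ?ell_ge0.
Qed.

Lemma ell_series_bounded c : exists M : R, forall N,
  \sum_(k < N) ell R k ^+ c / k.+1%:R ^+ 2 <= M.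
Proof.
have [M SM] := ell_telescope c; exists (2 * M) => N.
apply: (@le_trans _ _ (2 * \sum_(k < N) ell R k.+1 ^+ c / (k.+1%:R * k.+2%:R))).
  rewrite mulr_sumr; apply: ler_sum => k _; rewrite mulrCA.
  by rewrite ler_pM ?exprn_ge0 ?ell_ge0 ?invr_ge0 ?exprn_ge0 ?ellX_le ?inv_sqr_le.
rewrite ler_wpM2l //; apply: le_trans (SM N); rewrite lerDl.
by rewrite divr_ge0 ?exprn_ge0 ?ell_ge0.
Qed.

Lemma ell_bounded c : exists M : R, forall N, ell R N ^+ c / N.+1%:R <= M.
Proof.
have [M SM] := ell_telescope c; exists M => N; apply: le_trans (SM N).
apply: (@le_trans _ _ (ell R N.+1 ^+ c / N.+1%:R)).
  by rewrite ler_wpM2r ?invr_ge0 // ellX_le.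
rewrite lerDr sumr_ge0 // => k _.
by rewrite divr_ge0 ?mulr_ge0 ?exprn_ge0 ?ell_ge0.
Qed.

End LogarithmicSeries.

(** Boundedness for the exponent $2c$ bounds the square by a constant over $N+1$. *)
Lemma ell_cvg0 (R : realType) (c : nat) :
  (fun N => ell R N ^+ c / N.+1%:R) @ \oo --> (0 : R).
Proof.
have [M bd] := ell_bounded R (2 * c).
have sq0 : (fun N => (ell R N ^+ c / N.+1%:R) ^+ 2) @ \oo --> (0 : R).
  apply: (@squeeze_cvgr _ _ _ _ (fun=> 0) (fun N => M * harmonic N)).
  - near=> N; rewrite sqr_ge0 /= exprMn -exprM mulnC expr2 mulrA.
    by rewrite /harmonic ler_wpM2r ?invr_ge0.
  - exact: cvg_cst.
  - rewrite -(mulr0 M); apply: cvgMr; exact: cvg_harmonic.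
have -> : (fun N => ell R N ^+ c / N.+1%:R)
  = (fun N => Num.sqrt ((ell R N ^+ c / N.+1%:R) ^+ 2)).
  by apply/funext => N; rewrite sqrtr_sqr ger0_norm // divr_ge0 ?exprn_ge0 ?ell_ge0.
rewrite -[X in _ --> X]sqrtr0.
by apply: (cvg_comp _ _ sq0); exact: sqrt_continuous.
Unshelve. all: by end_near.
Qed.

(** * Refinements and harmonic products as explicit lists *)

Lemma mem_map_cons (T : eqType) (d : T) (L : seq (seq T)) (s : seq T) :
  (s \in [seq d :: t | t : seq T <- L])
  = if s is c :: s' then (c == d) && (s' \in L) else false.
Proof.
apply/mapP/idP => [[t0 tL ->]|]; first by rewrite eqxx.
by case: s => // c s /andP[/eqP-> sL]; exists s.
Qed.

Section Combinatorics.
Local Open Scope nat_scope.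
Implicit Types (x y k n : nat) (a b s t : seq nat) (M : seq (nat * nat)).

Definition incr_head s := if s is y :: s' then y.+1 :: s' else [::].

(** A unit added in front of a composition either forms a part of its own or joins the first
    part. *)
Definition refine_step (L : seq (seq nat)) :=
  [seq (1%N :: s) | s <- L] ++ [seq incr_head s | s <- L].

(** The units of the first part are added one by one; this recursion in [x] matches the one for
    differences in [sum_last_summand_refs]. *)
Fixpoint refs a : seq (seq nat) :=
  if a is x :: a' then iter x.-1 refine_step [seq (1%N :: s) | s <- refs a']
  else [:: [::]].

Lemma refs1 a : refs (1%N :: a) = [seq (1%N :: s) | s <- refs a].
Proof. by []. Qed.

Lemma refsSS x a : refs (x.+2 :: a) = refine_step (refs (x.+1 :: a)).
Proof. by []. Qed.

Arguments refs : simpl never.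

(** The partial sums of the reversed sequence, together with 0 and the weight; these two extremes
    are harmless when weights agree. *)
Fixpoint suffix_sums a : seq nat :=
  if a is y :: b then sumn a :: suffix_sums b else [:: 0%N].

Lemma suffix_sums_le a n : n \in suffix_sums a -> (n <= sumn a)%N.
Proof.
elim: a => [|x a IH] /=; first by rewrite inE => /eqP->.
rewrite inE => /predU1P[->//|/IH /leq_trans]; apply; exact: leq_addl.
Qed.

Lemma sumn_suffix_sums a : sumn a \in suffix_sums a.
Proof. by case: a => [|x a]; rewrite mem_head. Qed.

Lemma suffix_sums0 a : 0%N \in suffix_sums a.
Proof. by elim: a => //= x a IH; rewrite inE IH orbT. Qed.

Definition refining s a : bool :=
  [&& all (leq 1) s, sumn s == sumn a & all (mem (suffix_sums s)) (suffix_sums a)].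

(** Once the weights agree, the full sum of [x :: a] is matched by that of [y :: s], and the sums of
    [a] are strictly smaller, so only those of [s] can match them. *)
Lemma refining_cons y s x a : (0 < x)%N ->
  refining (y :: s) (x :: a)
  = [&& (0 < y)%N, all (leq 1) s, y + sumn s == x + sumn a
      & all (mem (suffix_sums s)) (suffix_sums a)].
Proof.
move=> x0; rewrite /refining /= -andbA; case: posnP => //= y0; congr (_ && _).
rewrite inE; case: eqP => //= E; rewrite E eqxx /=; apply: eq_in_all => n /suffix_sums_le na.
by rewrite /= inE; case: eqP => //= nE; lia.
Qed.

Lemma refining_nil_cons x a : (0 < x)%N -> refining [::] (x :: a) = false.
Proof. by move=> x0; rewrite /refining /=; case: eqP => //=; lia. Qed.

(** The first part of [s] tells which half of [refine_step] produced it: a part 1 was prepended, a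
    larger one was incremented. *)
Lemma mem_refs a s : all (leq 1) a -> (s \in refs a) = refining s a.
Proof.
elim: a s => [|[//|x] a IHa] s.
  move=> _; rewrite /refs inE /refining /= andbT suffix_sums0 andbT.
  case: s => //= y s; case: posnP => //= y0.
  by case: eqP; rewrite ?andbF //; lia.
move=> /= a_gt0; elim: x s => [|x IHx] s.
  rewrite refs1 mem_map_cons; case: s => [|y s]; first by rewrite refining_nil_cons.
  rewrite IHa // refining_cons // /refining.
  case: (ltngtP y 1) => [|y1|->]; [by case: y| |by rewrite add1n eqSS].
  (* For [y > 1] the weights force [sumn s < sumn a], so [sumn a] is no suffix sum of [s]. *)
  symmetry; apply/negbTE; apply/negP => /and4P[_ _ /eqP E /allP sub].
  by have /suffix_sums_le := sub _ (sumn_suffix_sums a); lia.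
rewrite refsSS mem_cat mem_map_cons.
case: s => [|[|[|y]] s].
- rewrite refining_nil_cons //=; apply/mapP => -[[|y s]]; last by [].
  by rewrite IHx refining_nil_cons.
- by rewrite refining_cons //=; apply/mapP => -[[|y t] _] [].
- rewrite eqxx /= IHx refining_cons // orbC.
  have -> /= : (1%N :: s \in [seq incr_head t | t <- refs (x.+1 :: a)]) = false.
    apply/mapP => -[[|y t]]; rewrite IHx ?refining_nil_cons // refining_cons //.
    by case: y.
  rewrite {1}/refining /= add1n addSn eqSS; congr (_ && _); case: eqP => //= E.
  by rewrite -E sumn_suffix_sums.
rewrite (_ : (y.+2 == 1%N) = false) //= refining_cons // !addSn eqSS.
have -> : (y.+2 :: s \in [seq incr_head t | t <- refs (x.+1 :: a)])
    = (y.+1 :: s \in refs (x.+1 :: a)).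
  apply/mapP/idP => [[[|z t]//= tL [-> ->]//]|sL]; by exists (y.+1 :: s).
by rewrite IHx refining_cons // !addSn eqSS.
Qed.

Lemma uniq_refs a : all (leq 1) a -> uniq (refs a).
Proof.
elim: a => [//|[//|x] a IHa] /= a_gt0.
have cons1_inj : injective (cons 1%N) by move=> s t [].
elim: x => [|x IHx]; first by rewrite refs1 map_inj_uniq ?IHa.
have incr_mem s : s \in refs (x.+1 :: a) -> exists y t, s = y.+1 :: t.
  rewrite mem_refs //; case: s => [|[|y] t]; first by rewrite refining_nil_cons.
    by rewrite refining_cons.
  by move=> _; exists y, t.
rewrite refsSS cat_uniq map_inj_uniq // IHx /=; apply/andP; split.
  apply/hasPn => _ /mapP[s /incr_mem[y [t ->]] ->]; rewrite mem_map_cons /=.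
  by [].
rewrite map_inj_in_uniq // => s t /incr_mem[y [s' ->]] /incr_mem[z [t' ->]] /=.
by case=> -> ->.
Qed.

Lemma suffix_sumsE a : suffix_sums a = [seq sumn (drop i a) | i <- iota 0 (size a).+1].
Proof.
elim: a => // x a IH; rewrite [LHS]/= IH.
have -> : iota 0 (size (x :: a)).+1 = 0 :: [seq i.+1 | i <- iota 0 (size a).+1].
  by rewrite -(iotaDl 1).
by rewrite map_cons -map_comp.
Qed.

(** Dropping [x] removes the full weight and [0 < n] removes the empty suffix, the two values that
    [partial_sums] leaves out. *)
Lemma partial_sums_rev x a n : all (leq 1) a ->
  (n \in partial_sums (rev (x :: a))) = (0 < n) && (n \in suffix_sums a).
Proof.
move=> a_gt0; rewrite /partial_sums suffix_sumsE size_rev.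
have pos i : (i < size a)%N -> (0 < sumn (drop i a))%N.
  by move=> ia; rewrite (drop_nth 0%N ia) /= addn_gt0 (all_nthP 0%N a_gt0).
have takeE k : (k <= size a)%N -> sumn (take k (rev (x :: a))) = sumn (drop (size a - k) a).
  by move=> ka; rewrite take_rev sumn_rev /= subSn.
apply/mapP/andP => [[k]|[n0 nS]].
  rewrite mem_iota => /andP[k0 ka] nE; rewrite /= in ka.
  rewrite nE takeE //; split; first by apply: pos; lia.
  by apply/mapP; exists (size a - k)%N => //; rewrite mem_iota; lia.
move/mapP: nS n0 => [i]; rewrite mem_iota => /andP[_ ia'] -> n0.
case: (ltnP i (size a)) => ia; last first.
  by move: n0; rewrite drop_oversize.
exists (size a - i)%N; first by rewrite mem_iota /=; lia.
by rewrite takeE ?leq_subr // subKn // ltnW.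
Qed.

Lemma refines_rev a s : all (leq 1) a -> all (leq 1) s -> a != [::] ->
  refines (rev s) (rev a) <-> refining s a.
Proof.
case: a => // x a /andP[x0 a0] s0 _; rewrite /refines /weight !sumn_rev /refining s0 /=.
case: s s0 => [|y s /andP[y0 s_gt0]].
  by move=> _; split => [[]|/andP[/eqP]] /=; lia.
split=> [[E sub]|/andP[/eqP E /andP[_ /allP sub]]]; rewrite /= in E.
  rewrite /= E eqxx inE eqxx /=; apply/allP => n na.
  have [->|n0] := posnP n; first by rewrite !inE suffix_sums0 orbT.
  have /sub : n \in partial_sums (rev (x :: a)) by rewrite partial_sums_rev // n0.
  by rewrite partial_sums_rev // => /andP[_ nS]; rewrite !inE nS orbT.
split=> // n; rewrite !partial_sums_rev // => /andP[-> na] /=.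
have := sub _ na; rewrite !inE => /predU1P[nE|//].
by have := suffix_sums_le na; rewrite /= in nE *; lia.
Qed.

Lemma multiindex_rev a : multiindex (rev a) = (a != [::]) && all (leq 1) a.
Proof. by rewrite /multiindex all_rev -!size_eq0 size_rev. Qed.

Lemma refinements_rev a : multiindex (rev a) ->
  refinements (rev a) = [set` [seq rev s | s <- refs a]].
Proof.
rewrite multiindex_rev => /andP[a_n0 a_gt0]; apply/seteqP; split=> s /=.
  rewrite -(revK s); move: (rev s) => t [].
  rewrite multiindex_rev => /andP[_ t_gt0] /(refines_rev a_gt0 t_gt0 a_n0).
  by rewrite -mem_refs // => ta; apply/mapP; exists t.
move=> /mapP[t]; rewrite mem_refs // => ta ->.
have /and3P[t_gt0 /eqP tE _] := ta; split; last exact/refines_rev.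
rewrite multiindex_rev t_gt0 andbT.
case: a a_n0 a_gt0 tE {ta} => // x a _ /andP[x0 _].
by case: t t_gt0 => //= _; lia.
Qed.

(** Quasi-shuffle recursion on the first column, whose zero lies in the second row, in the first
    row, or nowhere. The inner fixpoint serves the calls that shorten only [b]. *)
Fixpoint hmat a : seq nat -> seq (seq (nat * nat)) :=
  fix hmat_a b :=
    match a, b with
    | [::], [::] => [:: [::]]
    | x :: a', [::] => [seq (x, 0) :: M | M <- hmat a' [::]]
    | [::], y :: b' => [seq (0, y) :: M | M <- hmat_a b']
    | x :: a', y :: b' =>
        [seq (x, 0) :: M | M <- hmat a' b] ++ [seq (0, y) :: M | M <- hmat_a b']
        ++ [seq (x, y) :: M | M <- hmat a' b']
    end.

Lemma hmat_nil_cons y b : hmat [::] (y :: b) = [seq (0, y) :: M | M <- hmat [::] b].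
Proof. by []. Qed.

Lemma hmat_cons_nil x a : hmat (x :: a) [::] = [seq (x, 0) :: M | M <- hmat a [::]].
Proof. by []. Qed.

Lemma hmat_cons_cons x a y b : hmat (x :: a) (y :: b) =
  [seq (x, 0) :: M | M <- hmat a (y :: b)] ++ [seq (0, y) :: M | M <- hmat (x :: a) b]
  ++ [seq (x, y) :: M | M <- hmat a b].
Proof. by []. Qed.

Arguments hmat : simpl never.

Definition hmat_spec M a b : bool :=
  [&& [seq x <- unzip1 M | x != 0] == a, [seq x <- unzip2 M | x != 0] == b
    & all (fun c => 0 < c.1 + c.2) M].

Lemma mem_hmat a b M : all (leq 1) a -> all (leq 1) b ->
  (M \in hmat a b) = hmat_spec M a b.
Proof.
elim: M a b => [|[c d] M IH] a b a_gt0 b_gt0.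
  case: a b a_gt0 b_gt0 => [|x a] [|y b] _ _; rewrite ?hmat_nil_cons ?hmat_cons_nil ?hmat_cons_cons.
  - by [].
  - by rewrite mem_map_cons.
  - by rewrite mem_map_cons.
  - by rewrite !mem_cat !mem_map_cons.
case: a b a_gt0 b_gt0 => [|x a] [|y b];
  rewrite ?hmat_nil_cons ?hmat_cons_nil ?hmat_cons_cons ?mem_cat ?mem_map_cons /=.
- by case: c d => [|c] [|d]; rewrite /hmat_spec /= ?andbF.
- case: y => // y _ b0; rewrite IH // /hmat_spec /= xpair_eqE.
  case: c d => [|c] [|d] //=; rewrite ?andbF //=.
  by rewrite ?eqseq_cons -?andbA; do !bool_congr.
- case: x => // x a0 _; rewrite IH // /hmat_spec /= xpair_eqE.
  case: c d => [|c] [|d] //=; rewrite ?andbF //=.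
  by rewrite ?eqseq_cons -?andbA; do !bool_congr.
move=> /andP[x0 a0] /andP[y0 b0]; rewrite !IH //= ?x0 ?y0 //.
rewrite /hmat_spec /= !xpair_eqE.
case: x y x0 y0 => [//|x] [//|y] _ _.
case: c d => [|c] [|d]; rewrite /= ?andbF ?orbF ?eqseq_cons //=.
- by rewrite -!andbA; do !bool_congr.
- by rewrite -!andbA; do !bool_congr.
by rewrite -!andbA; do !bool_congr.
Qed.

Lemma uniq_hmat a b : all (leq 1) a -> all (leq 1) b -> uniq (hmat a b).
Proof.
have inj (d : nat * nat) : injective (cons d) by move=> s t [].
elim: a b => [|x a IHa] b; elim: b => [|y b IHb] //.
- by move=> _ /andP[_ b0]; rewrite hmat_nil_cons map_inj_uniq ?IHb.
- by move=> /andP[_ a0] _; rewrite hmat_cons_nil map_inj_uniq ?IHa.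
move=> /= /andP[x0 a0] /andP[y0 b0]; rewrite hmat_cons_cons.
have Ha : uniq (hmat a (y :: b)) by rewrite IHa //= y0.
have Hb : uniq (hmat (x :: a) b) by rewrite IHb //= x0.
rewrite !cat_uniq !map_inj_uniq // Ha Hb IHa //= andbT; apply/andP; split.
  rewrite has_cat negb_or; apply/andP; split.
    apply/hasPn => _ /mapP[M _ ->]; rewrite mem_map_cons xpair_eqE.
    by rewrite eq_sym (gtn_eqF x0).
  apply/hasPn => _ /mapP[M _ ->]; rewrite mem_map_cons xpair_eqE.
  by rewrite (gtn_eqF y0) andbF.
apply/hasPn => _ /mapP[M _ ->]; rewrite mem_map_cons xpair_eqE.
by rewrite (gtn_eqF x0).
Qed.

Lemma harmonic_matrices_rev a b : all (leq 1) a -> all (leq 1) b ->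
  harmonic_matrices (rev a) (rev b) = [set` [seq rev M | M <- hmat a b]].
Proof.
move=> a0 b0; apply/seteqP; split=> M /=.
  move=> [Ma Mb Mp]; apply/mapP; exists (rev M); last by rewrite revK.
  rewrite mem_hmat // /hmat_spec /unzip1 /unzip2 !map_rev !filter_rev Ma Mb !revK !eqxx all_rev.
  exact/allP.
move=> /mapP[N]; rewrite mem_hmat // => /and3P[/eqP Na /eqP Nb /allP Np] ->.
rewrite /harmonic_matrices /= /unzip1 /unzip2 !map_rev !filter_rev; split.
- by congr rev.
- by congr rev.
- by move=> c; rewrite mem_rev => /Np.
Qed.

End Combinatorics.
Arguments refs : simpl never.
Arguments hmat : simpl never.

(** * Truncated multiple zeta sums *)

Section TruncatedSums.
Variable R : realFieldType.
Implicit Types (x y k n N K m : nat) (a b s t : seq nat) (M : seq (nat * nat)).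

(* Indices are stored reversed, the exponent of the largest summation variable
   first: [htrunc (rev mu) N] is f_mu(N). *)
Fixpoint htrunc a N : R :=
  if a is x :: a' then \sum_(n < N) n.+1%:R ^- x * htrunc a' n else 1.

Lemma htrunc_cons x a N :
  htrunc (x :: a) N = \sum_(n < N) n.+1%:R ^- x * htrunc a n.
Proof. by []. Qed.

Arguments htrunc : simpl never.

Lemma htrunc_consS x a N :
  htrunc (x :: a) N.+1 = htrunc (x :: a) N + N.+1%:R ^- x * htrunc a N.
Proof. by rewrite !htrunc_cons big_ord_recr. Qed.

Lemma htrunc_cons0 x a : htrunc (x :: a) 0 = 0.
Proof. by rewrite htrunc_cons big_ord0. Qed.

Lemma htrunc_ge0 a N : 0 <= htrunc a N.
Proof.
elim: a N => [|x a IH] N; first exact: ler01.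
by rewrite sumr_ge0 // => n _; rewrite mulr_ge0 ?invr_ge0 ?exprn_ge0.
Qed.

Lemma logbd_htrunc a : all (leq 1) a -> logbd (sumn a) (htrunc a).
Proof.
elim: a => [|[//|x] a IH] /=; first by move=> _; exact: logbd1.
by move=> /IH; rewrite addnC; exact: logbd_sum.
Qed.

Lemma sum_htrunc_cons (c : nat * nat) (L : seq (seq (nat * nat))) N :
  \sum_(M <- [seq c :: M | M <- L]) htrunc (column_sums M) N
  = \sum_(n < N) n.+1%:R ^- (c.1 + c.2) * \sum_(M <- L) htrunc (column_sums M) n.
Proof.
rewrite big_map exchange_big; apply: eq_bigr => n _.
by rewrite mulr_sumr.
Qed.

(** When $N$ grows by one, the increment of a product is the sum of three terms (left factor grows,
    right factor grows, both grow), which are the three branches of [hmat]. *)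
Lemma sum_htrunc_column_sums a b N :
  \sum_(M <- hmat a b) htrunc (column_sums M) N = htrunc a N * htrunc b N.
Proof.
elim: a b N => [|x a IHa] b.
  elim: b => [|y b IHb] N; first by rewrite big_seq1 mul1r.
  rewrite hmat_nil_cons sum_htrunc_cons mul1r; apply: eq_bigr => n _.
  by rewrite IHb mul1r.
elim: b => [|y b IHb] N.
  rewrite mulr1 hmat_cons_nil sum_htrunc_cons; apply: eq_bigr => n _.
  by rewrite IHa mulr1 addn0.
rewrite hmat_cons_cons !big_cat /= !sum_htrunc_cons /=.
elim: N => [|N IHN]; first by rewrite !big_ord0 htrunc_cons0 mul0r !addr0.
rewrite !(htrunc_consS x, htrunc_consS y) !big_ord_recr /= IHa IHb IHa.
rewrite [X in _ + X = _]addrACA [LHS]addrACA IHN addn0 add0n exprD invfM; ring.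
Qed.

Lemma kappa_diff0 (f : nat -> R) k :
  k.+1%:R * diff k f 0
  = \sum_(r < k.+1) diff r (fun n => n.+1%:R * f n) 0 :> R.
Proof.
rewrite -kappai0 kappa_diff; apply: eq_bigr => r _.
by rewrite addn0 binn mul1r.
Qed.

(** The part of the truncated sum whose largest variable equals $k+1$. *)
Definition last_summand s k : R := if s is y :: s' then k.+1%:R ^- y * htrunc s' k else 0.

Lemma htrunc_last_summand s N : s != [::] -> htrunc s N = \sum_(k < N) last_summand s k.
Proof. by case: s. Qed.

Lemma refs_cons_neq0 x a s : s \in refs (x.+1 :: a) -> s != [::].
Proof.
elim: x s => [|x IH] s; first by rewrite refs1 mem_map_cons; case: s.
rewrite refsSS mem_cat => /orP[|/mapP[t /IH]]; last by case: t => // y t _ ->.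
by rewrite mem_map_cons; case: s.
Qed.

(** After multiplication by $k+1$ both sides obey the same recursion in [x]. In [refine_step], a
    prepended 1 yields the last summands at all $n<k$ and an incremented head the one at $k$;
    together they give the sum over $r\le k$ of [kappa_diff0]. *)
Lemma sum_last_summand_refs x a k : all (leq 1) a ->
  (forall n, \sum_(s <- refs a) htrunc s n
     = (-1) ^+ size a * \sum_(r < n.+1) diff r (htrunc a) 0) ->
  \sum_(s <- refs (x.+1 :: a)) last_summand s k
  = (-1) ^+ size a * diff k (fun n => n.+1%:R ^- x.+1 * htrunc a n) 0.
Proof.
move=> a0 IHa; have k1 n : n.+1%:R != 0 :> R by rewrite pnatr_eq0.
elim: x k => [|x IHx] k; apply: (mulfI (k1 k)); rewrite [RHS]mulrCA kappa_diff0.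
  rewrite refs1 big_map -mulr_sumr IHa mulrA divff // mul1r; congr (_ * _).
  by apply: eq_bigr => r _; apply: eq_diff => n; rewrite expr1 mulVKf.
rewrite refsSS big_cat !big_map /= mulrDr.
rewrite -mulr_sumr mulrA divff // mul1r.
rewrite [X in X + _](_ : _ =
  \sum_(n < k) \sum_(s <- refs (x.+1 :: a)) last_summand s n); last first.
  rewrite exchange_big /=; apply: eq_big_seq => s /refs_cons_neq0 s0.
  by rewrite htrunc_last_summand.
rewrite [X in _ + X](_ : _ = \sum_(s <- refs (x.+1 :: a)) last_summand s k); last first.
  rewrite mulr_sumr; apply: eq_big_seq => -[|y s] /refs_cons_neq0 //= _.
  by rewrite exprS invfM !mulrA divff // mul1r.
rewrite -(big_ord_recr k (fun n : 'I_k.+1 => \sum_(s <- refs (x.+1 :: a)) last_summand s n)) /=.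
rewrite mulr_sumr; apply: eq_bigr => r _; rewrite IHx; congr (_ * _).
by apply: eq_diff => n; rewrite [in RHS]exprS invfM !mulrA divff // mul1r.
Qed.

Lemma sum_htrunc_refs a k : all (leq 1) a ->
  \sum_(s <- refs a) htrunc s k
  = (-1) ^+ size a * \sum_(r < k.+1) diff r (htrunc a) 0.
Proof.
elim: a k => [|[//|x] a IH] k a0.
  rewrite /refs big_seq1 mul1r big_ord_recl big1 ?addr0 // => r _.
  by rewrite (@eq_diff _ _ _ (fun=> 1)) // diff1.
rewrite big_ord_recl (_ : diff ord0 _ _ = 0); last exact: htrunc_cons0.
rewrite add0r mulr_sumr.
rewrite (eq_big_seq (fun s => \sum_(n < k) last_summand s n)); last first.
  by move=> s /refs_cons_neq0; exact: htrunc_last_summand.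
rewrite exchange_big /=; apply: eq_bigr => n _.
rewrite sum_last_summand_refs => [|//|i]; last exact: IH.
rewrite /bump /= add1n exprS mulN1r mulNr -mulrN.
by rewrite (diffS_sum (fun n => n.+1%:R ^- x.+1 * htrunc a n)) opprK.
Qed.

Lemma diff_htrunc x a k : all (leq 1) (x :: a) ->
  diff k.+1 (htrunc (x :: a)) 0
  = (-1) ^+ size (x :: a) * \sum_(s <- refs (x :: a)) last_summand s k.
Proof.
case: x => // x a0; rewrite sum_last_summand_refs => [|//|i]; last exact: sum_htrunc_refs.
rewrite (diffS_sum (fun n => n.+1%:R ^- x.+1 * htrunc a n)).
by rewrite mulrA -exprD /= addSn exprS addnn -mul2n exprM sqrrN !expr1n mulr1 mulN1r.
Qed.

(** Elementary symmetric functions of $1,\ldots,1/n$ are truncated sums with all exponents 1. *)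
Lemma coef_rise1 n m : (rise R 1 n)`_m = htrunc (nseq m 1%N) n.
Proof.
elim: n m => [|n IH] m.
  by rewrite [rise _ _ _]/rise coef1; case: m => //= m; rewrite htrunc_cons0.
rewrite riseS add1n coefZ mulrDr coefD coefMX coefMC !IH.
case: m => [|m] /=; first by rewrite add0r mulrCA mulVf ?pnatr_eq0 // mulr1.
by rewrite htrunc_consS expr1 mulrDr mulrCA mulVf ?pnatr_eq0 // mulr1 addrC.
Qed.

Lemma coef_rise0S n m : (rise R 0 n.+1)`_m.+1 = n.+1%:R^-1 * htrunc (nseq m 1%N) n.
Proof. by rewrite riseSl addr0 coefZ [_ * rise _ _ _]mulrC coefMX coef_rise1. Qed.

Lemma coef_rise0S0 n : (rise R 0 n.+1)`_0 = 0.
Proof. by rewrite riseSl addr0 coefZ [_ * rise _ _ _]mulrC coefMX mulr0. Qed.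

Lemma coef0_newton K (f : nat -> R) : (newton K f)`_0 = f 0%N.
Proof.
rewrite coef_sum big_ord_recl /= coefZ coef1 mulr1 big1 ?addr0 // => k _.
by rewrite coefZ /bump add1n coef_rise0S0 mulr0.
Qed.

(** The coefficient of [rise R 0 k.+1] supplies $1/(k+1)$, which raises the leading exponent by one,
    and a truncated sum of ones, which multiplies the tail harmonically: this is the circled product
    with $m+1$ ones. *)
Lemma coef_newton_htrunc K x a m : all (leq 1) (x :: a) ->
  (newton K (htrunc (x :: a)))`_m.+1
  = (-1) ^+ size (x :: a) * \sum_(s <- refs (x :: a))
      \sum_(M <- hmat (behead s) (nseq m 1%N)) htrunc ((head 0 s).+1 :: column_sums M)%N K.
Proof.
move=> a0; rewrite coef_sum big_ord_recl /= coefZ coef1 mulr0 add0r.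
under eq_bigr => k _ do
  rewrite coefZ /bump /= add1n (diff_htrunc _ a0) coef_rise0S -mulrA mulr_suml.
rewrite -mulr_sumr exchange_big /=; congr (_ * _); apply: eq_big_seq => s.
case: x a0 => // x _ /refs_cons_neq0; case: s => //= y s _.
rewrite exchange_big /=; apply: eq_bigr => k _.
by rewrite -mulr_sumr sum_htrunc_column_sums exprS invfM; ring.
Qed.

End TruncatedSums.
Arguments htrunc : simpl never.

(** * Passage to the limit *)

Section ZetaLimit.
Variable R : realType.
Implicit Types (x y k n N p : nat) (a b s : seq nat).

Fixpoint monomial a s : R :=
  match a, s with
  | x :: a', n :: s' => n%:R ^- x * monomial a' s'
  | _, _ => 1
  end.

Lemma monomial_ge0 a s : 0 <= monomial a s.
Proof.
by elim: a s => [|x a IH] [|n s] //=; rewrite mulr_ge0 ?invr_ge0 ?exprn_ge0.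
Qed.

Lemma monomial_rcons a s x n : size a = size s ->
  monomial (rcons a x) (rcons s n) = monomial a s * n%:R ^- x.
Proof.
elim: a s => [|y a IH] [|m s] //=; first by rewrite mulrC.
by move=> [/IH ->]; rewrite mulrA.
Qed.

Lemma monomial_rev a s : size a = size s -> monomial (rev a) (rev s) = monomial a s.
Proof.
elim: a s => [|y a IH] [|m s] //= [as_]; rewrite !rev_cons.
by rewrite monomial_rcons ?size_rev // IH // mulrC.
Qed.

Lemma monomial_prod a s : size a = size s ->
  monomial a s = \prod_(i < size a) (nth 0%N s i)%:R ^- nth 0%N a i.
Proof.
elim: a s => [|x a IH] [|n s] //=; first by rewrite big_ord0.
by move=> [/IH ->]; rewrite big_ord_recl.
Qed.

(** Decreasing lists of positive numbers below [k]. As [k] ends the increasing path, [k = 0] admits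
    nothing, even for [p = 0]. *)
Definition decr_below p k : set (seq nat) :=
  [set s | size s = p /\ path ltn 0%N (rcons (rev s) k)].

Definition decr p : set (seq nat) := [set s | size s = p /\ path ltn 0%N (rev s)].

Lemma decr_below0 k : (0 < k)%N -> decr_below 0 k = [set [::]].
Proof.
move=> k0; apply/seteqP; split=> [s [/eqP/nilP -> //]|_ ->].
by split; rewrite //= k0.
Qed.

Lemma decr_belowk0 p : decr_below p 0 = set0.
Proof.
by apply/seteqP; split=> [s [_]|//]; rewrite rcons_path /= ltn0 andbF.
Qed.

Lemma decrS p : decr p.+1 = \bigcup_k (cons k @` decr_below p k).
Proof.
apply/seteqP; split=> [[|k s] [] // [sp]|s [k _ [t [tp pt] <-]]].
  by rewrite rev_cons => ps; exists k => //; exists s.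
by split; rewrite /= ?tp ?rev_cons.
Qed.

Lemma decr_belowS p k :
  decr_below p.+1 k.+1 = \bigcup_n (cons n @` (if (n <= k)%N then decr_below p n else set0)).
Proof.
apply/seteqP; split=> [[|n s] [] // [sp]|s [n _ [t]]].
  rewrite rcons_path rev_cons last_rcons => /andP[ps nk].
  by exists n => //; exists s; rewrite // -ltnS (nk : (n < k.+1)%N).
case: ifP => // nk [tp pt] <-; split; first by rewrite /= tp.
by rewrite rcons_path rev_cons last_rcons pt /= ltnS.
Qed.

Lemma trivIset_cons (D : nat -> set (seq nat)) : trivIset setT (fun k => cons k @` D k).
Proof. by move=> i j _ _ [s [[t _ <-] [u _ []]]] . Qed.

(** Splits off the largest variable; [c] collects the powers split off earlier, so that the lemma
    can be iterated. *)
Lemma esum_bigcup_cons (D : nat -> set (seq nat)) x a (c : R) : 0 <= c ->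
  (\esum_(s in \bigcup_k (cons k @` D k)) (c * monomial (x :: a) s)%:E
  = \sum_(0 <= k <oo) \esum_(s in D k) (c * k%:R ^- x * monomial a s)%:E)%E.
Proof.
move=> c0; rewrite nneseries_sum_bigcup => [|//|s]; [|exact: trivIset_cons|]; last first.
  by rewrite lee_fin mulr_ge0 ?monomial_ge0.
apply: eq_eseriesr => k _; rewrite esum_image; last by move=> s t _ _ [].
by apply: eq_esum => s _; rewrite /= mulrA.
Qed.

Lemma esum_decr_below a (c : R) k : 0 <= c ->
  (\esum_(s in decr_below (size a) k.+1) (c * monomial a s)%:E
   = (c * htrunc R a k)%:E)%E.
Proof.
elim: a c k => [|x a IH] c k c0.
  by rewrite decr_below0 // esum_set1 // lee_fin mulr_ge0.
rewrite decr_belowS esum_bigcup_cons //.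
have F0 n : (0 <= \esum_(s in if (n <= k)%N then decr_below (size a) n else set0)
    (c * n%:R ^- x * monomial a s)%:E)%E.
  by apply: esum_ge0 => s _; rewrite lee_fin !mulr_ge0 ?monomial_ge0 ?invr_ge0 ?exprn_ge0.
rewrite (nneseries_split 0 k.+1) // add0n [X in (_ + X)%E]eseries0; last first.
  by move=> n kn _; rewrite leqNgt kn esum_set0.
rewrite adde0 big_mkord big_ord_recl /= decr_belowk0 esum_set0 add0e.
rewrite htrunc_cons mulr_sumr -sumEFin; apply: eq_bigr => n _.
rewrite /bump /= add1n ltn_ord IH; first by rewrite mulrA.
by rewrite mulr_ge0 // invr_ge0 exprn_ge0.
Qed.

Lemma multizetaE x a :
  multizeta R (rev (x :: a))
  = fine (\sum_(0 <= k <oo) (if k is n.+1 then n.+1%:R ^- x * htrunc R a n else 0)%:E)%E.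
Proof.
rewrite /multizeta; congr fine.
pose e (t : (size (rev (x :: a))).-tuple nat) : seq nat := rev t.
transitivity (\esum_(s in decr (size (x :: a))) (1 * monomial (x :: a) s)%:E)%E.
  rewrite (@reindex_esum _ _ _ [set t : (size (rev (x :: a))).-tuple nat | path ltn 0%N t]
    _ e); last first.
    split=> [t /= pt|t u _ _ /(can_inj (@revK _)) /val_inj //|s [sp ps]].
      by split; rewrite /e ?size_rev ?size_tuple ?size_rev // revK.
    have sz : size (rev s) == size (rev (x :: a)) by rewrite !size_rev sp.
    by exists (Tuple sz) => //=; rewrite /e /= revK.
  apply: eq_esum => t _; rewrite mul1r /e -monomial_rev ?revK; last first.
    by rewrite size_rev size_tuple size_rev.
  rewrite monomial_prod ?size_tuple //; congr EFin; apply: eq_bigr => i _.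
  by rewrite (tnth_nth 0%N).
rewrite decrS esum_bigcup_cons //; apply: eq_eseriesr => -[|n] _.
  by rewrite decr_belowk0 esum_set0.
by rewrite esum_decr_below ?mul1r // invr_ge0 exprn_ge0.
Qed.

(** The truncations increase, and as [x] is at least 2 the logarithmic bound on [htrunc R a]
    dominates them by the series of [ell_series_bounded]. *)
Lemma htrunc_cvg_multizeta x a : (1 < x)%N -> all (leq 1) a ->
  htrunc R (x :: a) @ \oo --> multizeta R (rev (x :: a)).
Proof.
move=> x1 a0; have [a_bd _] := logbd_htrunc R a0.
have [M SM] := ell_series_bounded R (sumn a).
have cvg_h : cvgn (htrunc R (x :: a)).
  apply: nondecreasing_is_cvgn.
    apply/nondecreasing_seqP => n.
    by rewrite htrunc_consS lerDl mulr_ge0 ?htrunc_ge0 ?invr_ge0 ?exprn_ge0.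
  exists M => _ [N _ <-]; apply: le_trans (SM N); rewrite htrunc_cons.
  apply: ler_sum => n _; rewrite mulrC ler_pM ?htrunc_ge0 ?invr_ge0 ?exprn_ge0 //.
    by apply: le_trans (a_bd n); rewrite ler_norm.
  by rewrite lef_pV2 ?posrE ?exprn_gt0 // ler_weXn2l ?ler1n.
rewrite multizetaE (_ : (\sum_(0 <= k <oo) _)%E = (limn (htrunc R (x :: a)))%:E) //.
apply: cvg_lim => //; rewrite -cvg_shiftS (_ : [sequence _]_n = EFin \o htrunc R (x :: a)).
  by apply: (cvg_comp _ _ cvg_h).
apply/funext => N /=; rewrite big_mkord big_ord_recl /= add0e sumEFin.
by rewrite htrunc_cons.
Qed.

End ZetaLimit.

(** * Linear extension *)

Lemma cvg_sum_seq (R : realType) (I : eqType) (r : seq I) (F : I -> nat -> R) (l : I -> R) :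
  (forall i, i \in r -> F i @ \oo --> l i) ->
  (fun K => \sum_(i <- r) F i K) @ \oo --> \sum_(i <- r) l i.
Proof.
elim: r => [|i r IH] Fl.
  by under eq_fun do rewrite big_nil; rewrite big_nil; exact: cvg_cst.
under eq_fun do rewrite big_cons; rewrite big_cons.
apply: cvgD; first by apply: Fl; exact: mem_head.
by apply: IH => j jr; apply: Fl; rewrite inE jr orbT.
Qed.

(* [all_analysis] shadows the [basis] of Defs. *)
Local Notation basis := Defs.basis.

Section Evaluation.
Variable R : realType.
Implicit Types (phi psi : seq nat -> R) (v w : freeQ) (mu nu a b s : seq nat).
Implicit Types (k m n K : nat).

(** [zeta] unfolds to the case [phi := multizeta R]; truncated sums and Newton coefficients are
    further cases. *)
Definition ev phi v : R := \sum_(mu <- dom v) ratr (coeff mu v) * phi mu.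

(** Provides a common index list for vectors with different supports, as additivity requires. *)
Lemma ev_widen phi v (r : seq (seq nat)) : uniq r -> {subset dom v <= r} ->
  ev phi v = \sum_(mu <- r) ratr (coeff mu v) * phi mu.
Proof.
move=> r_uniq vr; rewrite (bigID (mem (dom v))) /= [X in _ + X]big1 ?addr0.
  rewrite -big_filter; apply: perm_big; apply: uniq_perm.
  - exact: uniq_dom.
  - exact: filter_uniq.
  - by move=> mu; rewrite mem_filter; case: (boolP (mu \in dom v)) => // /vr ->.
by move=> mu /coeff_outdom ->; rewrite rmorph0 mul0r.
Qed.

Lemma ev_linear phi c v w : ev phi (c *: v + w) = ratr c * ev phi v + ev phi w.
Proof.
pose r := undup (dom v ++ dom w ++ dom (c *: v + w)).
have r_uniq : uniq r by exact: undup_uniq.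
rewrite !(@ev_widen _ _ r) //;
  try by move=> mu mu_v; rewrite mem_undup !mem_cat mu_v ?orbT.
rewrite mulr_sumr -big_split; apply: eq_bigr => mu _ /=.
by rewrite coeffD coeffZ rmorphD rmorphM mulrDl mulrA.
Qed.

Lemma ev0 phi : ev phi 0 = 0.
Proof. by rewrite /ev dom0 big_nil. Qed.

Lemma ev_sum phi (I : Type) (r : seq I) (c : I -> rat) (F : I -> freeQ) :
  ev phi (\sum_(i <- r) c i *: F i) = \sum_(i <- r) ratr (c i) * ev phi (F i).
Proof.
elim: r => [|i r IH]; first by rewrite !big_nil ev0.
by rewrite !big_cons ev_linear IH.
Qed.

Lemma ev_sum1 phi (I : Type) (r : seq I) (F : I -> freeQ) :
  ev phi (\sum_(i <- r) F i) = \sum_(i <- r) ev phi (F i).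
Proof.
under eq_bigr do rewrite -[F _]scale1r.
by rewrite ev_sum; apply: eq_bigr => i _; rewrite rmorph1 mul1r.
Qed.

Lemma ev_basis phi mu : ev phi (basis mu) = phi mu.
Proof. by rewrite /ev /basis domU1 big_seq1 coeffU eqxx mulr1 rmorph1 mul1r. Qed.

Lemma ev_lift1 phi f v : ev phi (lift1 f v) = ev (fun mu => ev phi (f mu)) v.
Proof. by rewrite lift1E ev_sum. Qed.

Lemma eq_ev phi psi v : {in dom v, phi =1 psi} -> ev phi v = ev psi v.
Proof. by move=> E; apply: eq_big_seq => mu /E ->. Qed.

Lemma evB phi psi v : ev (fun mu => phi mu - psi mu) v = ev phi v - ev psi v.
Proof. by rewrite /ev -sumrB; apply: eq_bigr => mu _; rewrite mulrBr. Qed.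

Lemma ev_mul phi psi v w :
  ev phi v * ev psi w = ev (fun mu => ev (fun nu => phi mu * psi nu) w) v.
Proof.
rewrite mulr_suml; apply: eq_bigr => mu _; rewrite -mulrA; congr (_ * _).
by rewrite mulr_sumr; apply: eq_bigr => nu _; rewrite mulrCA.
Qed.

Lemma sum_ev (I : Type) (r : seq I) (phi : I -> seq nat -> R) v :
  \sum_(i <- r) ev (phi i) v = ev (fun mu => \sum_(i <- r) phi i mu) v.
Proof.
by rewrite exchange_big; apply: eq_bigr => mu _; rewrite mulr_sumr.
Qed.

Lemma cvg_ev (phi : nat -> seq nat -> R) psi v :
  (forall mu, mu \in dom v -> phi ^~ mu @ \oo --> psi mu) ->
  (fun K => ev (phi K) v) @ \oo --> ev psi v.
Proof.
move=> phi_cvg; apply: cvg_sum_seq => mu /phi_cvg; exact: cvgMr.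
Qed.

Lemma ev_sum_set phi (I : choiceType) (r : seq I) (F : I -> freeQ) :
  uniq r -> ev phi (\sum_(i \in [set` r]) F i) = \sum_(i <- r) ev phi (F i).
Proof. by move=> r_uniq; rewrite -fsbig_seq // ev_sum1. Qed.

Lemma ev_u_sigma phi v : v \in V ->
  ev phi (u (sigma v))
  = ev (fun mu => (-1) ^+ size mu * \sum_(s <- refs (rev mu)) phi (rev s)) v.
Proof.
move=> vV; rewrite /u /sigma !ev_lift1; apply: eq_ev => mu /(allP vV) mu_mi.
rewrite -[X in ev _ X]addr0 ev_linear ev0 addr0 rmorphXn rmorphN1 ev_basis; congr (_ * _).
rewrite -[in LHS](revK mu) refinements_rev ?revK // ev_sum_set; last first.
  rewrite map_inj_uniq ?uniq_refs //; last exact: can_inj (@revK _).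
  by move: mu_mi; rewrite -{1}(revK mu) multiindex_rev => /andP[].
by rewrite big_map; apply: eq_bigr => s _; rewrite ev_basis.
Qed.

Lemma ev_harmonic_product phi v w :
  all (all (leq 1)) (dom v) -> all (all (leq 1)) (dom w) ->
  ev phi (harmonic_product v w)
  = ev (fun mu => ev (fun nu =>
      \sum_(M <- hmat (rev mu) (rev nu)) phi (rev (column_sums M))) w) v.
Proof.
move=> v0 w0; rewrite /harmonic_product /lift2 ev_lift1.
apply: eq_ev => mu /(allP v0) mu0; rewrite ev_lift1; apply: eq_ev => nu /(allP w0) nu0.
rewrite -{1}(revK mu) -{1}(revK nu) harmonic_matrices_rev ?all_rev // ev_sum_set; last first.
  by rewrite map_inj_uniq ?uniq_hmat ?all_rev //; exact: can_inj (@revK _).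
by rewrite big_map; apply: eq_bigr => M _; rewrite ev_basis /column_sums map_rev.
Qed.

Lemma ev_circ_ones phi x a m : all (leq 1) a ->
  ev phi (circ (basis (rev (x :: a))) (ones m.+1))
  = \sum_(M <- hmat a (nseq m 1%N)) phi (rev (x.+1 :: column_sums M)).
Proof.
move=> a0; rewrite /circ /lift2 ev_lift1 ev_basis ev_lift1 ev_basis.
have -> : front (rev (x :: a)) = rev a.
  by rewrite /front size_rev rev_cons -cats1 take_size_cat // size_rev.
have -> : front (nseq m.+1 1%N) = nseq m 1%N.
  by rewrite /front size_nseq take_nseq.
have -> : last 0%N (rev (x :: a)) = x by rewrite rev_cons last_rcons.
have -> : last 0%N (nseq m.+1 1%N) = 1%N by rewrite /=; elim: m.
rewrite /concat /lift2 ev_lift1 ev_harmonic_product ?domU1 /= ?all_rev ?a0 ?all_nseq ?orbT //.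
rewrite !ev_basis revK rev_nseq; apply: eq_bigr => M _.
by rewrite ev_lift1 !ev_basis addn1 rev_cons cats1.
Qed.

End Evaluation.

Lemma rev_surj (T : Type) (s : seq T) : exists t, s = rev t.
Proof. by exists (rev s); rewrite revK. Qed.

(** * Newton coefficients of vectors and their limits *)

Section Kawashima.
Variable R : realType.
Implicit Types (v w : freeQ) (mu nu a b s : seq nat) (k m n K : nat).

Definition ztrunc K v : R := ev (fun mu => htrunc R (rev mu) K) v.

Lemma ztrunc_cvg_zeta v : v \in Vplus -> ztrunc ^~ v @ \oo --> zeta R v.
Proof.
move=> vV; apply: cvg_ev => mu /(allP vV) /andP[].
have [b ->] := rev_surj mu; rewrite multiindex_rev revK; case: b => // x a.
have -> : last 0%N (rev (x :: a)) = x by rewrite rev_cons last_rcons.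
by move=> /andP[_ /andP[_ a0]] x1; exact: htrunc_cvg_multizeta.
Qed.

Definition newton_coef K m v : R :=
  ev (fun mu => (newton K (htrunc R (rev mu)))`_m) v.

(** Exact at every truncation [K]: [coef_newton_htrunc] and [ev_circ_ones] sum over the same
    matrices. *)
Lemma ztrunc_circ_ones K m v : v \in V ->
  ztrunc K (circ (u (sigma v)) (ones m.+1)) = newton_coef K m.+1 v.
Proof.
move=> vV; rewrite /ztrunc /circ /lift2 ev_lift1 ev_u_sigma //.
apply: eq_ev => mu /(allP vV).
have [b ->] := rev_surj mu; rewrite multiindex_rev revK; case: b => // x a /andP[_ a0].
rewrite coef_newton_htrunc // size_rev; congr (_ * _); apply: eq_big_seq => s sa.
have /and3P[s0 _ _] : refining s (x :: a) by rewrite -mem_refs.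
case: s s0 sa => [|y s] /=.
  by rewrite mem_refs // refining_nil_cons //; case/andP: a0.
move=> /andP[_ s0] _.
have := ev_circ_ones (fun mu => htrunc R (rev mu) K) y m s0.
rewrite /circ /lift2 ev_lift1 ev_basis => ->.
by apply: eq_bigr => M _; rewrite /= revK.
Qed.

Lemma newton_coef0 K v : v \in V -> newton_coef K 0 v = 0.
Proof.
move=> vV; rewrite /newton_coef /ev big1_seq // => mu /(allP vV).
have [b ->] := rev_surj mu; rewrite multiindex_rev revK; case: b => // x a _.
by rewrite coef0_newton htrunc_cons0 mulr0.
Qed.

Lemma newton_coef_harmonic_product K m v w : v \in V -> w \in V ->
  newton_coef K m (harmonic_product v w)
  = ev (fun mu => ev (fun nu =>
      (newton K (fun n => htrunc R (rev mu) n * htrunc R (rev nu) n))`_m) w) v.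
Proof.
have pos x : x \in V -> all (all (leq 1)) (dom x).
  by move=> /allP xV; apply/allP => mu /xV /andP[].
move=> vV wV; rewrite /newton_coef ev_harmonic_product ?pos //.
apply: eq_ev => mu _; apply: eq_ev => nu _.
under eq_bigr do rewrite revK coef_sum.
rewrite exchange_big /= coef_sum; apply: eq_bigr => k _.
under eq_bigr do rewrite coefZ; rewrite coefZ -mulr_suml; congr (_ * _).
rewrite (@eq_diff _ k _
  (fun n => \sum_(M <- hmat (rev mu) (rev nu)) 1 * htrunc R (column_sums M) n)).
  by rewrite diff_sum; apply: eq_bigr => M _; rewrite mul1r.
by move=> n; rewrite -sum_htrunc_column_sums; apply: eq_bigr => M _; rewrite mul1r.
Qed.

Lemma newton_mul_cvg0 a b m : all (leq 1) a -> all (leq 1) b ->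
  (fun K => (newton K (htrunc R a) * newton K (htrunc R b)
     - newton K (fun n => htrunc R a n * htrunc R b n))`_m) @ \oo --> (0 : R).
Proof.
move=> /(logbd_htrunc R) a_bd /(logbd_htrunc R) b_bd.
pose c := (sumn a + sumn b + m).+1.
pose e K : R := 4 * m.+1%:R * (ell R K ^+ c / K.+1%:R).
have e0 : e @ \oo --> (0 : R) by rewrite -(mulr0 (4 * m.+1%:R)); apply: cvgMr; exact: ell_cvg0.
have bd K : `|(newton K (htrunc R a) * newton K (htrunc R b)
     - newton K (fun n => htrunc R a n * htrunc R b n))`_m| <= e K.
  by rewrite mulrC /e mulrA; exact: newton_mul_le.
apply: (@squeeze_cvgr _ _ _ _ (fun K => - e K) e) => //.
- by apply: nearW => K; rewrite -ler_norml.
- by rewrite -oppr0; exact: cvgN.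
Qed.

(** Cauchy product of polynomials; its two end terms drop out since a truncated sum of a nonempty
    index vanishes at 0 ([newton_coef0]). *)
Lemma newton_coef_mul K m v w : v \in V -> w \in V ->
  \sum_(1 <= k < m.+1) newton_coef K k v * newton_coef K (m.+1 - k) w
  = ev (fun mu => ev (fun nu =>
      (newton K (htrunc R (rev mu)) * newton K (htrunc R (rev nu)))`_m.+1) w) v.
Proof.
move=> vV wV.
transitivity (\sum_(0 <= k < m.+2) newton_coef K k v * newton_coef K (m.+1 - k) w).
  rewrite [RHS]big_ltn // [X in _ = _ + X]big_nat_recr //= newton_coef0 // subnn newton_coef0 //.
  by rewrite mul0r mulr0 add0r addr0.
under eq_bigr do rewrite /newton_coef ev_mul.
rewrite sum_ev; apply: eq_ev => mu _; rewrite sum_ev; apply: eq_ev => nu _.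
by rewrite coefM big_mkord.
Qed.

Lemma u_sigma_V v : v \in V -> u (sigma v) \in V.
Proof.
move=> vV; have sV : sigma v \in V.
  apply: spanned_lift1 => mu /(allP vV) mu_mi.
  by apply/allP => nu /domZ_subset; exact: (allP (spanned_basis mu_mi)).
apply: spanned_lift1 => mu _; apply: spanned_sum => nu.
rewrite in_finite_support; last first.
  by apply: sub_finite_set (finite_refinements mu) => s [].
by rewrite inE => -[[nu_mi _] _]; exact: spanned_basis.
Qed.

Lemma harmonic_product_V v w : v \in V -> w \in V -> harmonic_product v w \in V.
Proof.
move=> vV wV; apply: spanned_lift1 => mu /(allP vV) /andP[mu_n0 mu_gt0].
apply: spanned_lift1 => nu _; apply: spanned_sum => M.
rewrite in_finite_support; last first.
  by apply: sub_finite_set (finite_harmonic_matrices mu nu) => s [].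
rewrite inE => -[[Mmu _ M_gt0] _]; apply: spanned_basis; apply/andP; split.
  by apply: contraNneq mu_n0; rewrite -Mmu; case: (M).
by rewrite all_map; apply/allP => c /M_gt0.
Qed.

Lemma ones_V m : ones m.+1 \in V.
Proof. by apply: spanned_basis; rewrite /multiindex all_nseq orbT. Qed.

Lemma newton_coef_cvg m v : v \in V ->
  newton_coef ^~ m.+1 ^~ v @ \oo --> zeta R (circ (u (sigma v)) (ones m.+1)).
Proof.
move=> vV; under eq_fun do rewrite -ztrunc_circ_ones //.
by apply: ztrunc_cvg_zeta; apply: circ_Vplus; [exact: u_sigma_V|exact: ones_V].
Qed.

End Kawashima.

Theorem corollary5p4 (R : realType) (v w : freeQ) (m : nat)
    (hv : v \in V) (hw : w \in V) (hm : (1 <= m)%N) :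
  \sum_(1 <= k < m)
      zeta R (circ (u (sigma v)) (ones k)) *
      zeta R (circ (u (sigma w)) (ones (m - k)))
  = zeta R (circ (u (sigma (harmonic_product v w))) (ones m)).
Proof.
case: m hm => // m _; apply/eqP; rewrite -subr_eq0; apply/eqP.
(* The defect of the identity at truncation [K]; it tends to the difference [d] of the two sides and
   also to 0. *)
pose E K : R := \sum_(1 <= k < m.+1) newton_coef R K k v * newton_coef R K (m.+1 - k) w
  - newton_coef R K m.+1 (harmonic_product v w).
set d := _ - _; have Ed : E @ \oo --> d.
  apply: cvgB; last exact: newton_coef_cvg (harmonic_product_V hv hw).
  apply: cvg_sum_seq => -[|k]; rewrite mem_index_iota // => /andP[_ km].
  apply: cvgM; first exact: newton_coef_cvg.
  by rewrite subSn //; exact: newton_coef_cvg.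
suff E0 : E @ \oo --> (0 : R).
  by rewrite -(cvg_lim _ Ed) ?(cvg_lim _ E0).
have -> : E = fun K => ev (fun mu => ev (fun nu =>
    (newton K (htrunc R (rev mu)) * newton K (htrunc R (rev nu))
     - newton K (fun n => htrunc R (rev mu) n * htrunc R (rev nu) n))`_m.+1) w) v.
  apply/funext => K; rewrite /E newton_coef_mul // newton_coef_harmonic_product //.
  by rewrite -evB; apply: eq_ev => mu _; rewrite -evB; apply: eq_ev => nu _; rewrite coefB.
have ev00 x : ev (fun=> 0 : R) x = 0 by rewrite /ev big1 // => mu _; rewrite mulr0.
rewrite -[X in _ --> X](ev00 v); apply: cvg_ev => mu /(allP hv) /andP[_ mu0].
rewrite -[X in _ --> X](ev00 w); apply: cvg_ev => nu /(allP hw) /andP[_ nu0].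
by apply: newton_mul_cvg0; rewrite all_rev.
Qed.
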